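(* Let $f_i\in\Gamma_0(\mathbb{R}^{n_i})$, let $A_i$ be a real $m\times n_i$ matrix and $\alpha_i>0$ for $i=1,\dots,s$, and let $\beta>0$. Assume that the problem $$\min\Big\{\sum_{i=1}^s f_i(x_i):\ \sum_{i=1}^s A_ix_i=b,\ x_i\in\mathbb{R}^{n_i}\Big\}\qquad(\star)$$ has at least one solution and that $b\in A\big(\mathrm{ri}(\mathrm{dom}(\sum_{i=1}^s f_i))\big)$. For any $(x^0,y^0),(x^1,y^1)\in\mathbb{R}^n\times\mathbb{R}^m$, let $\{(x^k,y^k)\}_{k\in\mathbb{N}}$ be generated, for $k\ge1$, by $$\begin{cases}x_j^{k+1}=\mathrm{prox}_{\frac{\alpha_j}{\beta}f_j}\Big(x_j^k-\alpha_jA_j^\top\big(\sum_{i=1}^{j-1}A_ix_i^{k+1}+A_jx_j^k+\sum_{i=j+1}^sA_i(2x_i^k-x_i^{k-1})-b\big)-\frac{\alpha_j}{\beta}A_j^\top y^k\Big),\quad j=1,\dots,s,\\ y^{k+1}=y^k+\beta\big(\sum_{i=1}^sA_ix_i^{k+1}-b\big).\end{cases}$$ If $0<\alpha_i<\dfrac{1}{\|A_i\|_2^2+2\|\widetilde M_2\|_2}$ for all $i=1,\dots,s$, then the sequence $\{x^k\}$ converges to a solution of problem $(\star)$.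
   Context: $s,m,n_1,\dots,n_s$ are positive integers, $n=\sum_i n_i$, $\mathbb{R}^n=\mathbb{R}^{n_1}\times\cdots\times\mathbb{R}^{n_s}$. $\Gamma_0(\mathbb{R}^d)$: proper lower semicontinuous convex functions $\mathbb{R}^d\to\mathbb{R}\cup\{+\infty\}$. $A=[A_1\ \cdots\ A_s]$, $b\in\mathbb{R}^m$. $\sum_i f_i$ denotes $x\mapsto\sum_i f_i(x_i)$ on $\mathbb{R}^n$; $\mathrm{ri}$ is relative interior. $\mathrm{prox}_\varphi(x)=\mathrm{argmin}_u\{\frac12\|u-x\|_2^2+\varphi(u)\}$. $\widetilde M_2$ is the $(n+m)\times(n+m)$ matrix, partitioned into blocks of sizes $n_1,\dots,n_s,m$, whose $(i,j)$ block is $A_i^\top A_j$ for $1\le i<j\le s$ and whose other blocks are all $0$. $\|\cdot\|_2$ of a matrix is its largest singular value; $\frac10$ is read as $+\infty$. *)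

(* Defs.v *)
From HB Require Import structures.
From mathcomp Require Import all_boot all_order all_algebra.
From mathcomp Require Import all_classical all_reals all_analysis.

Set Implicit Arguments.
Unset Strict Implicit.
Unset Printing Implicit Defensive.

Import Order.TTheory GRing.Theory Num.Theory.
Import numFieldNormedType.Exports.

Local Open Scope classical_set_scope.
Local Open Scope ring_scope.

(* MathComp-Analysis puts the sup norm on ['cV[R]_d]; it induces the Euclidean
   topology, but [prox] needs the Euclidean norm itself. *)
Definition norm2 (R : realType) (d : nat) (u : 'cV[R]_d) : R :=
  Num.sqrt (\sum_(i < d) u i 0 ^+ 2).

Section ExtendedValued.
Context {R : realType}.
Local Open Scope ereal_scope.

Definition proper_fun (T : Type) (f : T -> \bar R) : Prop :=
  (forall x, f x != -oo) /\ (exists x, f x < +oo).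

(* For proper [f] the right-hand side is never [+oo - oo], and the library's
   convention [0 * +oo = 0] makes the cases [t = 0] and [t = 1] trivial. *)
Definition convex_efun (d : nat) (f : 'cV[R]_d -> \bar R) : Prop :=
  forall (x y : 'cV[R]_d) (t : R), (0 <= t <= 1)%R ->
    f (t *: x + (1 - t) *: y)%R <= t%:E * f x + (1 - t)%:E * f y.

Definition Gamma0 (d : nat) : set ('cV[R]_d -> \bar R) :=
  [set f | [/\ proper_fun f, lower_semicontinuous f & convex_efun f]].

Definition dom (T : Type) (f : T -> \bar R) : set T := [set x | f x < +oo].

Definition argmin (T : Type) (C : set T) (g : T -> \bar R) : set T :=
  [set x | C x /\ forall z, C z -> g x <= g z].

(* For [phi] in [Gamma0] the argmin is a singleton, so the default value [0] of
   [xget] is never used. *)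
Definition prox (d : nat) (phi : 'cV[R]_d -> \bar R) (x : 'cV[R]_d) : 'cV[R]_d :=
  xget 0%R (argmin setT (fun u => (2^-1 * norm2 (u - x) ^+ 2)%:E + phi u)).

(* A point of R^{n_1} x ... x R^{n_s} is a stacked column vector, whose i-th
   component is [submxcol x i]. *)
Definition sepsum (s : nat) (n : 'I_s -> nat)
    (f : forall i, 'cV[R]_(n i) -> \bar R) (x : 'cV[R]_(\sum_i n i)) : \bar R :=
  \sum_(i < s) f i (submxcol x i).

End ExtendedValued.

Section RelativeInterior.
Context {R : realType} {d : nat}.
Implicit Type S : set 'cV[R]_d.

Definition affine_hull S : set 'cV[R]_d :=
  [set x | exists (k : nat) (w : 'I_k -> R) (v : 'I_k -> 'cV[R]_d),
    [/\ \sum_i w i = 1, forall i, S (v i) & x = \sum_i w i *: v i]].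

Definition ri S : set 'cV[R]_d :=
  [set x | affine_hull S x /\ \forall z \near x, affine_hull S z -> S z].

End RelativeInterior.

(* When [M] is wide, this adds [0] to the usual min(p, q) singular values, which
   does not change the largest one. *)
Definition singular_values (R : realType) (p q : nat) (M : 'M[R]_(p, q)) :
    set R :=
  [set sigma | 0 <= sigma /\ eigenvalue (M^T *m M) (sigma ^+ 2)].

(* The set of singular values is finite, so its [sup] is its maximum. *)
Definition specnorm (R : realType) (p q : nat) (M : 'M[R]_(p, q)) : R :=
  sup (singular_values M).

Definition M2tilde (R : realType) (s m : nat) (n : 'I_s -> nat)
    (A : forall i, 'M[R]_(m, n i)) : 'M[R]_(\sum_i n i + m) :=
  block_mx
    (\mxblock_(i < s, j < s) (if (i < j)%N then (A i)^T *m A j else 0)) 0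
    0 0.

Definition feasible (R : realType) (s m : nat) (n : 'I_s -> nat)
    (A : forall i, 'M[R]_(m, n i)) (b : 'cV[R]_m) : set 'cV[R]_(\sum_i n i) :=
  [set x | \sum_(i < s) A i *m submxcol x i = b].

(* Main.v *)
Require Import Defs.
From HB Require Import structures.
From mathcomp Require Import all_boot all_order all_algebra.
From mathcomp Require Import all_classical all_reals all_analysis.
From mathcomp Require Import ring lra.

Import Order.TTheory GRing.Theory Num.Theory.
Import numFieldNormedType.Exports.

Local Open Scope classical_set_scope.
Local Open Scope ring_scope.

Set Implicit Arguments.
Unset Strict Implicit.
Unset Printing Implicit Defensive.

(** The update is a primal-dual proximal method in which the block [j] sees the
    blocks [i < j] already updated and the blocks [i > j] extrapolated.  Write
    [d k = x k - x k.-1] and eliminate [y k] in favour of [y k.+1].  The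
    optimality condition of the proximal steps then takes the implicit form

      [- beta (P d k.+1 - U (d k.+1 - d k)) - A^T y k.+1] is a subgradient of
      [f 1 + ... + f s] at [x k.+1],

    where [P] is block diagonal with blocks [1 / alpha j - A_j^T A_j] and [U] is
    the strictly upper triangular part of [A^T A], that is, the matrix M2tilde
    without its zero border ([prox_step_subgradient]).

    Let [(p, q)] be a saddle point, i.e. [- A^T q] is a subgradient at [p] and
    [A p = b].  Monotonicity of the subdifferential between [x k.+1] and [p]
    shows that

      [|x k - p|_P^2 / 2 + |y k - q|^2 / (2 beta^2) - (U d k, x k - p)
         + u |d k|^2 / 2],   with [u] the spectral norm of [U],

    decreases by at least a multiple of [|d k.+1|^2 + |y k.+1 - y k|^2]
    ([energy_descent]).  The bound on the step sizes says exactly that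
    [P - 2 u] is positive definite, which makes the decrease strict and the
    energy coercive ([energy_ge]).  Hence the iterates are bounded and the
    increments vanish; every cluster point is again a saddle point, because the
    subdifferential has a closed graph, and the energy relative to that cluster
    point decreases to [0], so that the whole sequence converges to it
    ([monotone_iteration_cvg], stated for an arbitrary closed monotone
    relation).

    Three facts feed this argument.  A saddle point exists by the
    relative-interior hypothesis: the Lagrange multiplier is a functional
    supporting a convex cone in [R^m x R], obtained one coordinate at a time
    ([lagrange_multiplier]).  Proximal points exist and satisfy the expected
    first-order condition ([prox_subgradient]).  Finally the supremum of the
    singular values bounds the matrix as an operator ([specnorm_sqr_le]),
    because the supremum of the Rayleigh quotient is an eigenvalue. *)

(** * Euclidean inner product *)

Definition dotp {R : realType} {d : nat} (u v : 'cV[R]_d) : R :=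
  (u^T *m v) 0 0.

Section InnerProduct.
Context {R : realType} {d : nat}.
Implicit Types (u v w : 'cV[R]_d) (a : R).

Lemma dotpE u v : dotp u v = \sum_i u i 0 * v i 0.
Proof. by rewrite /dotp mxE; apply: eq_bigr => i _; rewrite mxE. Qed.

Lemma dotpC u v : dotp u v = dotp v u.
Proof. by rewrite !dotpE; apply: eq_bigr => i _; rewrite mulrC. Qed.

Lemma dotpDl u v w : dotp (u + v) w = dotp u w + dotp v w.
Proof. by rewrite /dotp linearD /= mulmxDl mxE. Qed.

Lemma dotpDr u v w : dotp w (u + v) = dotp w u + dotp w v.
Proof. by rewrite /dotp mulmxDr mxE. Qed.

Lemma dotpNl u v : dotp (- u) v = - dotp u v.
Proof. by rewrite /dotp linearN /= mulNmx mxE. Qed.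

Lemma dotpNr u v : dotp u (- v) = - dotp u v.
Proof. by rewrite /dotp mulmxN mxE. Qed.

Lemma dotpBl u v w : dotp (u - v) w = dotp u w - dotp v w.
Proof. by rewrite dotpDl dotpNl. Qed.

Lemma dotpBr u v w : dotp w (u - v) = dotp w u - dotp w v.
Proof. by rewrite dotpDr dotpNr. Qed.

Lemma dotpZl a u v : dotp (a *: u) v = a * dotp u v.
Proof. by rewrite /dotp linearZ /= -scalemxAl mxE. Qed.

Lemma dotpZr a u v : dotp u (a *: v) = a * dotp u v.
Proof. by rewrite /dotp -scalemxAr mxE. Qed.

Lemma dotp0l u : dotp 0 u = 0.
Proof. by rewrite /dotp trmx0 mul0mx mxE. Qed.

Lemma dotp0r u : dotp u 0 = 0.
Proof. by rewrite /dotp mulmx0 mxE. Qed.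

Lemma dotp_ge0 u : 0 <= dotp u u.
Proof. by rewrite dotpE; apply: sumr_ge0 => i _; rewrite -expr2 sqr_ge0. Qed.

Lemma dotp_eq0 u : dotp u u = 0 -> u = 0.
Proof.
rewrite dotpE => /eqP.
rewrite psumr_eq0 => [/allP u0|i _]; last by rewrite -expr2 sqr_ge0.
apply/colP => i; rewrite mxE; apply/eqP.
by have := u0 i; rewrite mem_index_enum mulf_eq0 orbb => /(_ isT).
Qed.

Lemma norm2_sqr u : norm2 u ^+ 2 = dotp u u.
Proof.
rewrite /norm2 sqr_sqrtr; last by apply: sumr_ge0 => i _; rewrite sqr_ge0.
by rewrite dotpE; apply: eq_bigr => i _; rewrite expr2.
Qed.

Lemma norm2_ge0 u : 0 <= norm2 u.
Proof. exact: sqrtr_ge0. Qed.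

Lemma coord_le_norm2 u i : `|u i 0| <= norm2 u.
Proof.
rewrite -(ler_pXn2r (ltn0Sn 1)) ?nnegrE ?norm2_ge0 //.
rewrite norm2_sqr dotpE real_normK ?num_real // (bigD1 i) //= expr2.
by rewrite lerDl; apply: sumr_ge0 => j _; rewrite -expr2 sqr_ge0.
Qed.

End InnerProduct.

(** With [a], [b], [c] the values at [(u, u)], [(u, v)], [(v, v)] of a positive
    semidefinite form, the hypothesis evaluates that form at [t u - v]; the
    conclusion is the value at the minimiser [t = b / a].  It serves both the
    inner product and general semidefinite matrices. *)
Lemma CauchySchwarz_form (R : realType) (a b c : R) :
  0 <= a -> (forall t, 0 <= t ^+ 2 * a - 2 * t * b + c) -> b ^+ 2 <= a * c.
Proof.
move=> a0 H; have [aE|an0] := eqVneq a 0.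
  have c0 : 0 <= c by have := H 0; rewrite aE; lra.
  suff -> : b = 0 by rewrite aE; lra.
  apply/eqP; apply: contraT => bn0.
  (* a nonconstant affine function of [t] takes the value [-1] somewhere *)
  have := H ((c + 1) / (2 * b)); rewrite aE mulr0 add0r.
  have -> : 2 * ((c + 1) / (2 * b)) * b = c + 1 by field.
  lra.
have a_gt0 : 0 < a by lra.
have := H (b / a).
have -> : (b / a) ^+ 2 * a - 2 * (b / a) * b + c = (a * c - b ^+ 2) / a by field.
by rewrite pmulr_lge0 ?invr_gt0 // subr_ge0.
Qed.

Lemma dotp_CauchySchwarz (R : realType) (d : nat) (u v : 'cV[R]_d) :
  dotp u v ^+ 2 <= dotp u u * dotp v v.
Proof.
apply: CauchySchwarz_form; first exact: dotp_ge0.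
move=> t; have := dotp_ge0 (t *: u - v).
rewrite dotpBl !dotpBr !dotpZl !dotpZr (dotpC v u) !expr2; lra.
Qed.

Lemma dotp_le_norm2 (R : realType) (d : nat) (u v : 'cV[R]_d) :
  dotp u v <= norm2 u * norm2 v.
Proof.
have [/ltW h|h] := ltP (dotp u v) 0.
  by apply: le_trans h _; rewrite mulr_ge0 ?norm2_ge0.
rewrite -(ler_pXn2r (ltn0Sn 1)) ?nnegrE ?mulr_ge0 ?norm2_ge0 //.
by rewrite exprMn !norm2_sqr dotp_CauchySchwarz.
Qed.

Lemma dotp_adj (R : realType) (p q : nat) (M : 'M[R]_(p, q)) u v :
  dotp (M *m u) v = dotp u (M^T *m v).
Proof. by rewrite /dotp trmx_mul mulmxA. Qed.

Lemma norm2D (R : realType) (d : nat) (u v : 'cV[R]_d) :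
  norm2 (u + v) <= norm2 u + norm2 v.
Proof.
rewrite -(ler_pXn2r (ltn0Sn 1)) ?nnegrE ?addr_ge0 ?norm2_ge0 //.
rewrite sqrrD !norm2_sqr dotpDl !dotpDr (dotpC v u).
have := dotp_le_norm2 u v; rewrite mulr2n; lra.
Qed.

Lemma norm2Z (R : realType) (d : nat) (a : R) (u : 'cV[R]_d) :
  0 <= a -> norm2 (a *: u) = a * norm2 u.
Proof.
move=> a0; apply/eqP; rewrite -(eqrXn2 (ltn0Sn 1)) ?mulr_ge0 ?norm2_ge0 //.
by rewrite exprMn !norm2_sqr dotpZl dotpZr expr2 mulrA.
Qed.

Lemma dotp_blocks (R : realType) (s : nat) (n : 'I_s -> nat)
    (u v : 'cV[R]_(\sum_i n i)) :
  dotp u v = \sum_i dotp (submxcol u i) (submxcol v i).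
Proof.
rewrite -{1}(submxcolK u) -{1}(submxcolK v) /dotp tr_mxcol mul_mxrow_mxcol.
by rewrite summxE.
Qed.

(** * Convergence of vectors along a filter *)

Section VectorConvergence.
Context {R : realType} {T : Type} {F : set_system T} {FF : ProperFilter F}.

Lemma cvg_coordP (d : nat) (x : T -> 'cV[R]_d) (l : 'cV[R]_d) :
  x @ F --> l <-> forall i, (fun t => x t i 0) @ F --> l i 0.
Proof.
split=> [xl i|xl].
  by apply: (cvg_comp x (fun M : 'cV[R]_d => M i 0) xl); exact: coord_continuous.
apply/cvgrPdist_lt => e e0.
have H : \forall t \near F, forall i, `|l i 0 - x t i 0| < e.
  apply: filter_forall => i.
  by move/cvgrPdist_lt : (xl i); exact.
apply: filterS H => t Ht.
rewrite [ltLHS]/Num.norm /= mx_normrE; apply/bigmax_ltP; split=> // -[i j] _ /=.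
by rewrite !mxE ord1.
Qed.

Lemma cvg_sumr (I : Type) (r : seq I) (f : I -> T -> R) (l : I -> R) :
  (forall i, f i @ F --> l i) ->
  (fun t => \sum_(i <- r) f i t) @ F --> \sum_(i <- r) l i.
Proof.
move=> fl; elim: r => [|i r IH].
  by rewrite big_nil; under eq_fun do rewrite big_nil; exact: cvg_cst.
by rewrite big_cons; under eq_fun do rewrite big_cons; exact: cvgD.
Qed.

Lemma cvg_dotp (d : nat) (x y : T -> 'cV[R]_d) (a b : 'cV[R]_d) :
  x @ F --> a -> y @ F --> b -> (fun t => dotp (x t) (y t)) @ F --> dotp a b.
Proof.
move=> /cvg_coordP xa /cvg_coordP yb.
under eq_fun do rewrite dotpE.
by rewrite dotpE; apply: cvg_sumr => i; exact: cvgM.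
Qed.

Lemma cvg_mulmx (p q : nat) (M : 'M[R]_(p, q)) (x : T -> 'cV[R]_q)
    (a : 'cV[R]_q) :
  x @ F --> a -> (fun t => M *m x t) @ F --> M *m a.
Proof.
move=> /cvg_coordP xa; apply/cvg_coordP => i.
under eq_fun do rewrite mxE.
rewrite mxE; apply: cvg_sumr => j; apply: cvgM => //; exact: cvg_cst.
Qed.

Lemma cvg_submxcol (s : nat) (n : 'I_s -> nat)
    (x : T -> 'cV[R]_(\sum_i n i)) (a : 'cV[R]_(\sum_i n i)) (i : 'I_s) :
  x @ F --> a -> (fun t => submxcol (x t) i) @ F --> submxcol a i.
Proof.
move=> /cvg_coordP xa; apply/cvg_coordP => j.
rewrite !mxE; under eq_fun do rewrite !mxE; exact: xa.
Qed.

Lemma cvg_dotp0 (d : nat) (x : T -> 'cV[R]_d) (a : 'cV[R]_d) :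
  (fun t => dotp (x t - a) (x t - a)) @ F --> 0 -> x @ F --> a.
Proof.
move=> /cvgrPdist_lt h; apply/cvg_coordP => i; apply/cvgrPdist_lt => e e0.
have e2 : 0 < e ^+ 2 by rewrite exprn_gt0.
apply: filterS (h _ e2) => t.
rewrite sub0r normrN ger0_norm ?dotp_ge0 // => ht; rewrite distrC.
have := coord_le_norm2 (x t - a) i; rewrite !mxE => /le_lt_trans; apply.
by rewrite -(ltr_pXn2r (ltn0Sn 1)) ?nnegrE ?norm2_ge0 ?ltW // norm2_sqr.
Qed.

End VectorConvergence.

(** Bolzano-Weierstrass in the form used below: instead of extracting
    subsequences, the limits are taken along an ultrafilter, which makes every
    bounded sequence converge at once. *)
Lemma ultra_bounded_cvg (R : realType) (T : Type) (U : set_system T)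
    (d : nat) (x : T -> 'cV[R]_d) (M : R) : UltraFilter U ->
  (\forall t \near U, norm2 (x t) <= M) -> exists a : 'cV[R]_d, x @ U --> a.
Proof.
move=> UU bx.
have H i : exists a : R, (fun t => x t i 0) @ U --> a.
  have /(_ ((fun t => x t i 0) @ U)) := @segment_compact R (- M) M.
  case.
    apply: filterS bx => t xt /=.
    by rewrite in_itv /= -ler_norml; exact: le_trans (coord_le_norm2 _ _) xt.
  move=> p [_ clp]; exists p => B pB.
  have [//|nB] := @in_ultra_setVsetC _ U ((fun t => x t i 0) @^-1` B) UU.
  by have [z []] := clp (~` B) B nB pB.
have /choice[a ha] := H; exists (\col_i a i).
by apply/cvg_coordP => i; rewrite mxE; exact: ha.
Qed.

(** The epigraph of a lower semicontinuous function is closed.  The bound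
    [c t] is allowed to vary so that inequalities between values of [f] and
    convergent expressions pass to the limit in one step. *)
Lemma lsc_cvg_le (R : realType) (T : Type) (F : set_system T)
    (X : topologicalType) (f : X -> \bar R)
    (u : T -> X) (c : T -> R) (u0 : X) (c0 : R) : ProperFilter F ->
  lower_semicontinuous f -> u @ F --> u0 -> c @ F --> c0 ->
  (\forall t \near F, (f (u t) <= (c t)%:E)%E) -> (f u0 <= c0%:E)%E.
Proof.
move=> FF lf uu0 cc0 fc; rewrite leNgt; apply/negP => c0f.
have [a /andP[c0a af]] : exists a : R, (c0%:E < a%:E)%E && (a%:E < f u0)%E.
  move: c0f; case: (f u0) => [r|_|//].
    rewrite lte_fin => c0r; exists ((c0 + r) / 2).
    by rewrite !lte_fin !midf_lt.
  by exists (c0 + 1); rewrite ltry andbT lte_fin ltrDl.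
have [V u0V Va] := lf _ _ af.
have : \forall t \near F, a < c t.
  near=> t; rewrite -lte_fin; apply: (@lt_le_trans _ _ (f (u t))).
    apply: Va; near: t; exact: uu0.
  by near: t.
rewrite lte_fin in c0a.
have : \forall t \near F, c t < a by move/cvgr_lt : cc0; exact.
move=> h1 h2; have [t []] := filter_ex (filterI h1 h2).
by move=> /lt_trans /[apply]; rewrite ltxx.
Unshelve. all: by end_near. Qed.

(** * The spectral norm bounds the matrix as an operator *)

Lemma mulmx_dotp_bounded (R : realType) (p q : nat) (M : 'M[R]_(p, q)) :
  exists2 C : R, 0 < C & forall u, dotp (M *m u) (M *m u) <= C * dotp u u.
Proof.
pose r i := (row i M)^T.
exists (1 + \sum_i dotp (r i) (r i)).
  by rewrite ltr_pwDl // sumr_ge0 // => i _; exact: dotp_ge0.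
move=> u; rewrite mulrDl mul1r mulr_suml dotpE.
rewrite -[leLHS]add0r lerD ?dotp_ge0 // ler_sum // => i _.
have -> : (M *m u) i 0 = dotp (r i) u.
  by rewrite /dotp trmxK -row_mul [RHS]mxE.
by rewrite -expr2 dotp_CauchySchwarz.
Qed.

Lemma psd_CauchySchwarz (R : realType) (q : nat) (N : 'M[R]_q) u v :
  N^T = N -> (forall w, 0 <= dotp (N *m w) w) ->
  dotp (N *m u) v ^+ 2 <= dotp (N *m u) u * dotp (N *m v) v.
Proof.
move=> symN psdN; apply: CauchySchwarz_form => // t.
have := psdN (t *: u - v).
rewrite mulmxBr -scalemxAr dotpBl !dotpBr !dotpZl !dotpZr.
by rewrite (dotp_adj N v u) symN (dotpC v) expr2; lra.
Qed.

(** An invertible positive semidefinite form is bounded below: with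
    [v = N u] in the Cauchy-Schwarz inequality,
    [|N u|^2 <= C (N u, u)], and [|u|^2 <= C' |N u|^2]. *)
Lemma psd_unit_coercive (R : realType) (q : nat) (N : 'M[R]_q) :
  N^T = N -> (forall w, 0 <= dotp (N *m w) w) -> N \in unitmx ->
  exists2 c : R, 0 < c & forall u, c * dotp u u <= dotp (N *m u) u.
Proof.
move=> symN psdN unitN.
have [C C0 HC] := mulmx_dotp_bounded N.
have [C' C'0 HC'] := mulmx_dotp_bounded (invmx N).
exists (C' * (C + 1))^-1; first by rewrite invr_gt0 mulr_gt0 // addr_gt0.
move=> u; rewrite mulrC ler_pdivrMr ?mulr_gt0 ?addr_gt0 //.
have h1 : dotp u u <= C' * dotp (N *m u) (N *m u).
  by have := HC' (N *m u); rewrite mulKmx.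
apply: le_trans h1 _; rewrite mulrCA ler_pM2l //.
set a := dotp (N *m u) (N *m u).
have a0 : 0 <= a by exact: dotp_ge0.
have h2 : a ^+ 2 <= dotp (N *m u) u * ((C + 1) * a).
  apply: le_trans (psd_CauchySchwarz u (N *m u) symN psdN) _.
  rewrite ler_wpM2l //; apply: le_trans (dotp_le_norm2 _ _) _.
  set w := N *m u.
  have h := HC w.
  have h3 : norm2 (N *m w) * norm2 w <= (norm2 (N *m w) ^+ 2 + norm2 w ^+ 2) / 2.
    by have := sqr_ge0 (norm2 (N *m w) - norm2 w); rewrite sqrrB; lra.
  apply: le_trans h3 _; rewrite !norm2_sqr.
  have -> : a = dotp w w by [].
  have := dotp_ge0 w; have := mulr_ge0 (ltW C0) (dotp_ge0 w).
  lra.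
have [->|an0] := eqVneq a 0.
  by rewrite mulr_ge0 // addr_ge0 // ltW.
have a_gt0 : 0 < a by rewrite lt_neqAle eq_sym an0.
by rewrite -(ler_pM2r a_gt0) -expr2 -mulrA.
Qed.

Section SpectralNorm.
Context {R : realType} {p q : nat} (M : 'M[R]_(p, q)) (q_gt0 : (0 < q)%N).

(** Values of the Rayleigh quotient on the unit sphere. *)
Let values : set R := [set dotp (M *m u) (M *m u) | u in [set u | dotp u u = 1]].

Let has_sup_values : has_sup values.
Proof.
split.
  exists (dotp (M *m delta_mx (Ordinal q_gt0) 0) (M *m delta_mx (Ordinal q_gt0) 0)).
  exists (delta_mx (Ordinal q_gt0) 0) => //=.
  rewrite dotpE (bigD1 (Ordinal q_gt0)) //= !mxE !eqxx mulr1.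
  by rewrite big1 ?addr0 // => i /negPf ne; rewrite !mxE ne mul0r.
have [C _ HC] := mulmx_dotp_bounded M.
by exists C => _ [u /= u1 <-]; apply: le_trans (HC u) _; rewrite u1 mulr1.
Qed.

Let lambda := sup values.

Let le_lambda u : dotp (M *m u) (M *m u) <= lambda * dotp u u.
Proof.
have [u0|un0] := eqVneq (dotp u u) 0.
  by rewrite (dotp_eq0 u0) mulmx0 !dotp0l mulr0.
have u_gt0 : 0 < norm2 u.
  rewrite lt_neqAle norm2_ge0 andbT eq_sym.
  by apply: contra un0 => /eqP h; rewrite -norm2_sqr h expr0n.
have h : values (dotp (M *m u) (M *m u) / dotp u u).
  exists ((norm2 u)^-1 *: u) => /=.
    rewrite dotpZl dotpZr -norm2_sqr mulrA -expr2 exprVn mulVf //.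
    by rewrite expf_neq0 // gt_eqF.
  rewrite -scalemxAr dotpZl dotpZr -(norm2_sqr u) mulrA -expr2 exprVn.
  by rewrite mulrC.
have := sup_upper_bound has_sup_values h.
by rewrite ler_pdivrMr // lt_neqAle eq_sym un0 dotp_ge0.
Qed.

Let lambda_ge0 : 0 <= lambda.
Proof.
have [[v [u /= u1 uv]] _] := has_sup_values.
by have := le_lambda u; rewrite u1 mulr1; apply: le_trans; exact: dotp_ge0.
Qed.

(** If the supremum [lambda] of the Rayleigh quotient were no eigenvalue, the
    form of [lambda - M^T M] would be coercive, so that [lambda] could be
    lowered. *)
Let eigenvalue_lambda : eigenvalue (M^T *m M) lambda.
Proof.
set N := lambda%:M - M^T *m M.
have NE u : dotp (N *m u) u = lambda * dotp u u - dotp (M *m u) (M *m u).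
  by rewrite mulmxBl dotpBl mul_scalar_mx dotpZl (dotp_adj M) mulmxA dotpC
    [in X in _ - X]dotpC.
have symN : N^T = N.
  by rewrite /N linearB /= tr_scalar_mx trmx_mul trmxK.
have psdN w : 0 <= dotp (N *m w) w by rewrite NE subr_ge0.
have nunit : N \notin unitmx.
  apply/negP => /(psd_unit_coercive symN psdN)[c c0 Hc].
  suff : lambda <= lambda - c by rewrite leNgt ltrBlDr ltrDl c0.
  apply: ge_sup; first by case: has_sup_values.
  by move=> _ [u /= u1 <-]; have := Hc u; rewrite NE u1; lra.
rewrite /eigenvalue /eigenspace kermx_eq0 row_free_unit.
by rewrite -opprB -/N -scaleN1r unitmxZ ?unitrN1.
Qed.

Let ubound_singular : ubound (singular_values M) (Num.sqrt lambda).
Proof.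
move=> sigma [s0 /eigenvalueP[v vE vn0]].
rewrite -(ler_pXn2r (ltn0Sn 1)) ?nnegrE ?sqrtr_ge0 // sqr_sqrtr //.
set u := v^T.
have uE : M^T *m M *m u = sigma ^+ 2 *: u.
  by rewrite /u -linearZ /= -vE !trmx_mul trmxK.
have u_gt0 : 0 < dotp u u.
  rewrite lt_neqAle eq_sym dotp_ge0 andbT; apply: contra vn0 => /eqP /dotp_eq0.
  by move/(congr1 trmx); rewrite trmxK trmx0 => ->.
rewrite -(ler_pM2r u_gt0); apply: le_trans (le_lambda u).
by rewrite (dotp_adj M) mulmxA uE dotpZr.
Qed.

Let sqrt_lambda_singular : singular_values M (Num.sqrt lambda).
Proof. by split; [exact: sqrtr_ge0|rewrite sqr_sqrtr // eigenvalue_lambda]. Qed.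

Lemma specnormE : specnorm M = Num.sqrt lambda.
Proof.
apply/eqP; rewrite eq_le; apply/andP; split.
  by apply: ge_sup ubound_singular; exists (Num.sqrt lambda).
apply: ub_le_sup => //; by exists (Num.sqrt lambda).
Qed.

Lemma specnorm_ge0 : 0 <= specnorm M.
Proof. by rewrite specnormE sqrtr_ge0. Qed.

Lemma specnorm_sqr_le u : dotp (M *m u) (M *m u) <= specnorm M ^+ 2 * dotp u u.
Proof. by rewrite specnormE sqr_sqrtr //; exact: le_lambda. Qed.

Lemma specnorm_le u v : dotp (M *m u) v <= specnorm M * (norm2 u * norm2 v).
Proof.
apply: le_trans (dotp_le_norm2 _ _) _.
rewrite mulrA ler_wpM2r ?norm2_ge0 //.
rewrite -(ler_pXn2r (ltn0Sn 1)) ?nnegrE ?mulr_ge0 ?norm2_ge0 ?specnorm_ge0 //.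
by rewrite exprMn !norm2_sqr specnorm_sqr_le.
Qed.

End SpectralNorm.

(** * Subgradients and proximal points *)

Definition subgradient {R : realType} {d : nat} (f : 'cV[R]_d -> \bar R)
    (x g : 'cV[R]_d) : Prop :=
  (f x < +oo)%E /\ forall z, (f x + (dotp g (z - x))%:E <= f z)%E.

Lemma proper_fineK (R : realType) (T : Type) (f : T -> \bar R) (x : T) :
  proper_fun f -> (f x < +oo)%E -> f x = (fine (f x))%:E.
Proof.
by move=> [fN _] fx; rewrite fineK // fin_numE fN /= lt_eqF.
Qed.

Lemma subgradient_monotone (R : realType) (d : nat) (f : 'cV[R]_d -> \bar R)
    (x1 g1 x2 g2 : 'cV[R]_d) : proper_fun f ->
  subgradient f x1 g1 -> subgradient f x2 g2 ->
  0 <= dotp (g1 - g2) (x1 - x2).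
Proof.
move=> pf [f1 s1] [f2 s2]; have := s1 x2; have := s2 x1.
rewrite (proper_fineK pf f1) (proper_fineK pf f2) -!EFinD !lee_fin.
by rewrite dotpBl !dotpBr; lra.
Qed.

(** The graph of the subdifferential is closed: in the subgradient inequality
    [f (x t) <= f z - (g t, z - x t)] the right-hand side converges and the
    left-hand side is lower semicontinuous. *)
Lemma subgradient_closed (R : realType) (d : nat) (T : Type) (F : set_system T)
    (f : 'cV[R]_d -> \bar R) (x g : T -> 'cV[R]_d) (x0 g0 : 'cV[R]_d) :
  ProperFilter F -> proper_fun f -> lower_semicontinuous f ->
  x @ F --> x0 -> g @ F --> g0 ->
  (\forall t \near F, subgradient f (x t) (g t)) -> subgradient f x0 g0.
Proof.
move=> FF pf lf xx0 gg0 sF.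
have H z : (f z < +oo -> f x0 <= (fine (f z) - dotp g0 (z - x0))%:E)%E.
  move=> fz.
  apply: (lsc_cvg_le (u := x)
    (c := fun t => fine (f z) - dotp (g t) (z - x t)) FF lf xx0).
    apply: cvgB; first exact: cvg_cst.
    by apply: cvg_dotp => //; apply: cvgB => //; exact: cvg_cst.
  apply: filterS sF => t [ft /(_ z)].
  rewrite (proper_fineK pf ft) (proper_fineK pf fz) -EFinD !lee_fin.
  by rewrite -lerBrDr.
have fx0 : (f x0 < +oo)%E.
  by have [z fz] := pf.2; apply: le_lt_trans (H z fz) _; rewrite ltry.
split=> // z; have [fz|] := ltP (f z) +oo%E; last by apply: le_trans; rewrite leey.
have := H z fz; rewrite (proper_fineK pf fx0) (proper_fineK pf fz) -EFinD.
by rewrite !lee_fin -lerBrDr.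
Qed.

Lemma nbhs_norm2_ball (R : realType) (d : nat) (x : 'cV[R]_d) V :
  nbhs x V ->
  exists2 delta : R, 0 < delta & forall u, norm2 (u - x) <= delta -> V u.
Proof.
move=> /nbhs_ballP[e /= e0 eV]; exists (e / 2); first by rewrite divr_gt0.
move=> u ux; apply: eV; split=> // i j.
rewrite /ball /= ord1 distrC; apply: (@le_lt_trans _ _ (e / 2)).
  by apply: le_trans ux; have := coord_le_norm2 (u - x) i; rewrite !mxE.
by rewrite ltr_pdivrMr // ltr_pMr // ltr1n.
Qed.

(** Lower semicontinuity bounds [phi] below on a small sphere around a point
    [x0] of its domain, and convexity along the rays from [x0] propagates that
    bound linearly. *)
Lemma Gamma0_minorant (R : realType) (d : nat) (phi : 'cV[R]_d -> \bar R) x0 :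
  Gamma0 phi -> (phi x0 < +oo)%E ->
  exists2 K : R, 0 <= K & forall u,
    ((fine (phi x0) - 1 - K * norm2 (u - x0))%:E <= phi u)%E.
Proof.
move=> [pphi lphi cphi] phix0.
have phi0 := proper_fineK pphi phix0.
set r0 := fine (phi x0) in phi0 *.
have lt_r0 : ((r0 - 1)%:E < phi x0)%E by rewrite phi0 lte_fin gtrBl.
have [V /nbhs_norm2_ball[delta delta0 dV] V_gt] := lphi _ _ lt_r0.
exists delta^-1; first by rewrite invr_ge0 ltW.
move=> u; have [ud|ud] := leP (norm2 (u - x0)) delta.
  apply: le_trans (ltW (V_gt _ (dV _ ud))); rewrite lee_fin gerBl.
  by rewrite mulr_ge0 ?norm2_ge0 // invr_ge0 ltW.
have [phiu|] := ltP (phi u) +oo%E; last by apply: le_trans; rewrite leey.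
rewrite (proper_fineK pphi phiu); set w := fine (phi u).
set rho := norm2 (u - x0) in ud *.
have rho0 : 0 < rho by exact: lt_trans ud.
pose t := delta / rho.
have t0 : 0 < t by rewrite divr_gt0.
have t1 : t <= 1 by rewrite ler_pdivrMr // mul1r ltW.
have := cphi u x0 t; rewrite t1 ltW // => /(_ isT).
rewrite (proper_fineK pphi phiu) phi0 -!EFinM -EFinD => /(lt_le_trans (V_gt _ _)).
rewrite lte_fin lee_fin => H.
have {H} : r0 - 1 < t * w + (1 - t) * r0.
  apply/H/dV.
  have -> : t *: u + (1 - t) *: x0 - x0 = t *: (u - x0).
    by rewrite scalerBl scale1r scalerBr addrA addrAC addrK.
  by rewrite norm2Z ?(ltW t0) // -/rho /t divfK ?gt_eqF.
move=> h; have h2 : - t^-1 < w - r0.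
  rewrite -(ltr_pM2l t0) mulrN divff ?gt_eqF //; lra.
have -> : delta^-1 * rho = t^-1 by rewrite /t invf_div mulrC.
lra.
Qed.

Section ProxExistence.
Context {R : realType} {d : nat} (phi : 'cV[R]_d -> \bar R) (x : 'cV[R]_d).
Hypothesis phiG : Gamma0 phi.

Let pphi : proper_fun phi. Proof. by case: phiG. Qed.

Let obj u : R := 2^-1 * norm2 (u - x) ^+ 2 + fine (phi u).

(** A linear minorant of [phi] loses against the quadratic term; half of the
    coefficient [2^-1] is spent on absorbing it. *)
Lemma prox_obj_coercive : exists c : R, forall u, (phi u < +oo)%E ->
  4^-1 * norm2 (u - x) ^+ 2 + c <= obj u.
Proof.
have [x0 phix0] := pphi.2.
have [K K0 HK] := Gamma0_minorant phiG phix0.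
exists (- K ^+ 2 + fine (phi x0) - 1 - K * norm2 (x - x0)) => u phiu.
have := HK u; rewrite (proper_fineK pphi phiu) lee_fin /obj => h.
have h1 : norm2 (u - x0) <= norm2 (u - x) + norm2 (x - x0).
  by have := norm2D (u - x) (x - x0); rewrite addrA subrK.
have h2 := ler_wpM2l K0 h1.
have h3 := sqr_ge0 (norm2 (u - x) / 2 - K).
move: h3 h h2; rewrite sqrrB exprMn; set T := norm2 (u - x).
have -> : T ^+ 2 * 2^-1 ^+ 2 - T / 2 * K *+ 2 + K ^+ 2 =
  4^-1 * T ^+ 2 - K * T + K ^+ 2 by field.
move=> *; lra.
Qed.

(** Direct method: by coercivity a minimising sequence is bounded, and lower
    semicontinuity passes to its limit along an ultrafilter. *)
Lemma prox_exists :
  exists p, (phi p < +oo)%E /\ forall u, (phi u < +oo)%E -> obj p <= obj u.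
Proof.
have [x0 phix0] := pphi.2.
have [c Hc] := prox_obj_coercive.
pose V := [set obj u | u in [set u | (phi u < +oo)%E]].
have hV : has_inf V.
  split; first by exists (obj x0), x0.
  exists c => _ [u /= phiu <-]; apply: le_trans (Hc _ phiu).
  by rewrite lerDr mulr_ge0 ?sqr_ge0 // invr_ge0 ler0n.
have min_seq k : exists u, (phi u < +oo)%E /\ obj u < inf V + k.+1%:R^-1.
  have k0 : 0 < k.+1%:R^-1 :> R by rewrite invr_gt0 ltr0n.
  by have [_ [u /= phiu <-] hu] := inf_adherent k0 hV; exists u.
have /choice[u Hu] := min_seq.
have [U [UU oU]] := ultraFilterLemma eventually_filter.
pose B := inf V + 1 - c.
have [w uw] : exists w : 'cV[R]_d, (fun k => u k - x) @ U --> w.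
  apply: (@ultra_bounded_cvg _ _ _ _ _ (2 * B + 1)).
  apply: filterE => k; have [phiu hu] := Hu k.
  have k1 : k.+1%:R^-1 <= 1 :> R by rewrite invf_le1 ?ltr0n // ler1n.
  have := Hc _ phiu; have := sqr_ge0 (norm2 (u k - x) - 1); rewrite sqrrB /B.
  move: hu k1; rewrite expr1n mulr1 mulr2n; set e := _^-1.
  by set T := norm2 _; set o := obj _; set i := inf _ => *; lra.
have uU : u @ U --> w + x.
  rewrite (_ : u = (fun k => (u k - x) + x)).
    by apply: cvgD => //; exact: cvg_cst.
  by apply/funext => k; rewrite subrK.
have harm : (fun k => k.+1%:R^-1 : R) @ U --> 0.
  by apply: cvg_trans (@cvg_harmonic R); apply: cvg_app.
have phi_lim : (phi (w + x) <= (inf V + 0 - 2^-1 * dotp w w)%:E)%E.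
  apply: (lsc_cvg_le (u := u) (c := fun k =>
    inf V + k.+1%:R^-1 - 2^-1 * dotp (u k - x) (u k - x)) _ _ uU).
  - by case: phiG.
  - apply: cvgB; first by apply: cvgD => //; exact: cvg_cst.
    by apply: cvgM; [exact: cvg_cst|exact: cvg_dotp].
  apply: filterE => k; have [phiu] := Hu k.
  rewrite (proper_fineK pphi phiu) lee_fin /obj norm2_sqr.
  by set e := k.+1%:R^-1 => *; lra.
have phip : (phi (w + x) < +oo)%E by apply: le_lt_trans phi_lim _; rewrite ltry.
exists (w + x); split=> // z phiz.
apply: (@le_trans _ _ (inf V)); last by apply: ge_inf; [case: hV|exists z].
move: phi_lim; rewrite (proper_fineK pphi phip) lee_fin /obj addrK norm2_sqr.
lra.
Qed.

Lemma prox_argmin :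
  (phi (prox phi x) < +oo)%E /\
  forall u, (phi u < +oo)%E -> obj (prox phi x) <= obj u.
Proof.
set g := fun u => ((2^-1 * norm2 (u - x) ^+ 2)%:E + phi u)%E.
have gE u : (phi u < +oo)%E -> g u = (obj u)%:E.
  by move=> phiu; rewrite /g (proper_fineK pphi phiu) -EFinD.
have [p [phip pmin]] := prox_exists.
have : argmin setT g (prox phi x).
  apply: xgetPex; exists p; split=> // z _; change (g p <= g z)%E.
  have [phiz|phiz] := ltP (phi z) +oo%E.
    by rewrite !gE // lee_fin pmin.
  rewrite /g; have -> : phi z = +oo%E by apply/eqP; rewrite eq_le leey.
  by rewrite addey // leey.
move=> [_ Hmin].
have phiq : (phi (prox phi x) < +oo)%E.
  have := Hmin p I; rewrite (gE p) // /g.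
  case: (phi (prox phi x)) (pphi.1 (prox phi x)) => [r _ _|_|//].
    exact: ltry.
  by rewrite addey.
by split=> // u phiu; have := Hmin u I; rewrite !gE // lee_fin.
Qed.

End ProxExistence.

(** Division by [t] and passage to the limit [t -> 0] in a first-order
    condition. *)
Lemma ge0_of_small_slope (R : realType) (a q : R) : 0 <= q ->
  (forall t, 0 < t -> t <= 1 -> 0 <= a + t * q) -> 0 <= a.
Proof.
move=> q0 H; rewrite leNgt; apply/negP => a0.
(* for [a < 0] the step [t = - a / (- a + q + 1)] is at most [1] and gives
   [t * q < - a] *)
have D0 : 0 < - a + q + 1 by lra.
have t0 : 0 < - a / (- a + q + 1) by rewrite divr_gt0 //; lra.
have t1 : - a / (- a + q + 1) <= 1 by rewrite ler_pdivrMr //; lra.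
have := H _ t0 t1; apply/negP; rewrite -ltNge.
have -> : a + - a / (- a + q + 1) * q = a * (1 - a) / (- a + q + 1).
  field; lra.
rewrite pmulr_llt0 ?invr_gt0 // nmulr_rlt0 //; lra.
Qed.

(** First-order optimality, read off along the segment from [prox phi x] to
    [z]. *)
Lemma prox_subgradient (R : realType) (d : nat) (phi : 'cV[R]_d -> \bar R) x :
  Gamma0 phi -> subgradient phi (prox phi x) (x - prox phi x).
Proof.
move=> phiG; have [pphi _ cphi] := phiG.
have [phip pmin] := prox_argmin x phiG.
move: phip pmin; set p := prox phi x => phip pmin.
split=> // z; have [phiz|] := ltP (phi z) +oo%E; last first.
  by apply: le_trans; rewrite leey.
rewrite (proper_fineK pphi phip) (proper_fineK pphi phiz) -EFinD lee_fin.
rewrite -subr_ge0; apply: (@ge0_of_small_slope _ _ (2^-1 * dotp (z - p) (z - p))).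
  by rewrite mulr_ge0 ?dotp_ge0 // invr_ge0 ler0n.
move=> t t0 t1.
have := cphi z p t; rewrite t1 ltW // => /(_ isT).
rewrite (proper_fineK pphi phip) (proper_fineK pphi phiz) -!EFinM -EFinD => conv.
have phiv : (phi (t *: z + (1 - t) *: p)%R < +oo)%E.
  by apply: le_lt_trans conv _; rewrite ltry.
have := pmin _ phiv; move: conv; rewrite (proper_fineK pphi phiv) lee_fin.
have -> : t *: z + (1 - t) *: p - x = t *: (z - p) - (x - p).
  by apply/matrixP => i j; rewrite !mxE; ring.
rewrite -(opprB x p) !norm2_sqr dotpNl dotpNr opprK.
rewrite (dotpBl (t *: (z - p))) !(dotpBr _ (x - p)) !(dotpZl, dotpZr).
rewrite (dotpC (z - p) (x - p)).
set Q := dotp (z - p) (z - p); set S := dotp (x - p) (z - p).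
set X := dotp (x - p) (x - p) => h1 h2.
rewrite -(pmulr_rge0 _ t0); lra.
Qed.

Lemma mule_ge0_neqNy (R : realType) (t : R) (a : \bar R) :
  0 <= t -> a != -oo%E -> (t%:E * a)%E != -oo%E.
Proof.
move=> t0; case: a => [r||] // _.
have [->|tn0] := eqVneq t 0; first by rewrite mul0e.
by rewrite gt0_muley // lte_fin lt_neqAle eq_sym tn0.
Qed.

Lemma neqNy_adde_def (R : realType) (a b : \bar R) :
  a != -oo%E -> b != -oo%E -> (a +? b)%E.
Proof. by move=> a0 b0; apply: ltninfty_adde_def; rewrite inE /= ltNye. Qed.

Lemma Gamma0_scale (R : realType) (d : nat) (f : 'cV[R]_d -> \bar R) (c : R) :
  0 < c -> Gamma0 f -> Gamma0 (fun u => (c%:E * f u)%E).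
Proof.
move=> c0 [pf lf cf].
have cE u : (f u < +oo)%E -> (c%:E * f u < +oo)%E.
  by move=> fu; rewrite (proper_fineK pf fu) -EFinM ltry.
split.
- split=> [u|]; first by rewrite mule_ge0_neqNy ?ltW // pf.1.
  by have [u fu] := pf.2; exists u; exact: cE.
- move=> u a au.
  have cM y : (a%:E < c%:E * f y)%E = ((c^-1 * a)%:E < f y)%E.
    by rewrite -[in RHS](@lte_pmul2l _ c%:E) // -EFinM mulVKf ?gt_eqF.
  rewrite cM in au; have [V uV HV] := lf u _ au.
  by exists V => // y /HV; rewrite cM.
- move=> u v t /[dup] t01 /andP[t0 t1].
  apply: (@le_trans _ _ (c%:E * (t%:E * f u + (1 - t)%:E * f v))%E).
    by rewrite lee_pmul2l //; exact: cf.
  rewrite muleDr //; first by rewrite !(muleCA c%:E).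
  by apply: neqNy_adde_def; rewrite mule_ge0_neqNy ?subr_ge0 // pf.1.
Qed.

Lemma subgradient_unscale (R : realType) (d : nat) (f : 'cV[R]_d -> \bar R)
    (c : R) (p g : 'cV[R]_d) : 0 < c -> proper_fun f ->
  subgradient (fun u => (c%:E * f u)%E) p g -> subgradient f p (c^-1 *: g).
Proof.
move=> c0 pf [cfp H].
have fp : (f p < +oo)%E.
  by move: cfp; case: (f p) => [r||] //; rewrite ?ltry // gt0_muley.
split=> // z; have [fz|] := ltP (f z) +oo%E; last by apply: le_trans; rewrite leey.
have := H z; rewrite (proper_fineK pf fp) (proper_fineK pf fz).
rewrite -!EFinM -!EFinD !lee_fin dotpZl => h.
by rewrite -(ler_pM2l c0) mulrDr mulVKf ?gt_eqF.
Qed.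

(** * Lagrange multipliers *)

(** Finite-dimensional Hahn-Banach theorem for a convex cone [K] in
    [R^m x R] whose projection to [R^m] is a linear subspace.  The functional is
    built one coordinate at a time: a value [eta] for the new coordinate [c] is
    admissible when [- r / c <= eta] on the elements with [c > 0] and
    [eta <= r / - c] on those with [c < 0], and adding two such elements so that
    [c] cancels shows that every lower constraint is below every upper one. *)
Lemma cone_supporting_functional (R : realType) (m : nat)
    (K : 'cV[R]_m -> R -> Prop) :
  (forall w r w' r', K w r -> K w' r' -> K (w + w') (r + r')) ->
  (forall t w r, 0 < t -> K w r -> K (t *: w) (t * r)) ->
  (forall r, K 0 r -> 0 <= r) ->
  (forall w r, K w r -> exists r', K (- w) r') ->
  exists y, forall w r, K w r -> 0 <= r + dotp y w.
Proof.
move=> KD KZ K0 KN.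
(* induction on the number [k] of leading coordinates of [w] allowed to be
   nonzero *)
suff H k : exists y, forall w r, K w r ->
    (forall i : 'I_m, (k <= i)%N -> w i 0 = 0) -> 0 <= r + dotp y w.
  have [y Hy] := H m; exists y => w r /Hy; apply=> i.
  by rewrite leqNgt ltn_ord.
elim: k => [|k [y Hy]].
  exists 0 => w r Kwr w0; rewrite dotp0l addr0; apply: K0.
  by rewrite (_ : 0 = w) //; apply/colP => i; rewrite mxE w0.
have [km|mk] := ltnP k m; last first.
  exists y => w r Kwr _; apply: Hy Kwr _ => i ki.
  by have := leq_trans mk ki; rewrite leqNgt ltn_ord.
pose i0 := Ordinal km.
pose supp (w : 'cV[R]_m) := forall i : 'I_m, (k.+1 <= i)%N -> w i 0 = 0.
have suppN w : supp w -> supp (- w) by move=> sw i ki; rewrite mxE sw ?oppr0.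
pose L := [set l : R | exists w r,
  [/\ K w r, supp w, 0 < w i0 0 & l = - (r + dotp y w) / w i0 0]].
have L_ub w r : K w r -> supp w -> w i0 0 < 0 ->
    ubound L ((r + dotp y w) / - w i0 0).
  move=> Kw sw w0 _ [w' [r' [Kw' sw' w'0 ->]]].
  have c0 : 0 < - w i0 0 by rewrite oppr_gt0.
  rewrite ler_pdivrMr // mulrAC ler_pdivlMr //.
  have := Hy _ _ (KD _ _ _ _ (KZ _ _ _ c0 Kw') (KZ _ _ _ w'0 Kw)).
  rewrite dotpDr !dotpZr.
  suff Hs : forall i : 'I_m, (k <= i)%N ->
      (- w i0 0 *: w' + w' i0 0 *: w) i 0 = 0 by move=> /(_ Hs); lra.
  move=> i; rewrite leq_eqVlt => /orP[/eqP ki|ki].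
    have -> : i = i0 by exact/val_inj.
    by rewrite !mxE; ring.
  by rewrite !mxE (sw i) // (sw' i) //; ring.
pose eta := if pselect (L !=set0) then sup L else 0.
exists (y + eta *: delta_mx i0 0) => w r Kw sw.
have -> : dotp (y + eta *: delta_mx i0 0) w = dotp y w + eta * w i0 0.
  rewrite dotpDl dotpZl; congr (_ + _ * _).
  rewrite dotpE (bigD1 i0) //= !mxE !eqxx mul1r big1 ?addr0 // => i /negPf ne.
  by rewrite !mxE ne mul0r.
have L_neg w' r' : K w' r' -> supp w' -> w' i0 0 < 0 -> L !=set0.
  move=> Kw' sw' w'0; have [r'' Kw''] := KN _ _ Kw'.
  exists (- (r'' + dotp y (- w')) / (- w') i0 0), (- w'), r''.
  by split=> //; [exact: suppN|rewrite mxE oppr_gt0].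
have [w0|w0|w0] := ltgtP (w i0 0) 0.
- have Ln0 := L_neg _ _ Kw sw w0.
  have : sup L <= (r + dotp y w) / - w i0 0 by apply: ge_sup => //; exact: L_ub.
  rewrite /eta; case: pselect => [?|/(_ Ln0)//] /=.
  by rewrite ler_pdivlMr ?oppr_gt0 //; lra.
- have Lw : L (- (r + dotp y w) / w i0 0) by exists w, r.
  have [r' Kw'] := KN _ _ Kw.
  have hL : has_ubound L.
    exists ((r' + dotp y (- w)) / - (- w) i0 0); apply: L_ub => //.
      exact: suppN.
    by rewrite mxE oppr_lt0.
  have : - (r + dotp y w) / w i0 0 <= sup L by exact: ub_le_sup.
  rewrite /eta; case: pselect => [? /=|[]]; last by exists (- (r + dotp y w) / w i0 0).
  by rewrite ler_pdivrMr //; lra.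
- rewrite w0 mulr0 addr0; apply: Hy Kw _ => i.
  rewrite leq_eqVlt => /orP[/eqP ki|ki]; last exact: sw.
  by rewrite -w0; congr (w _ _); exact/val_inj.
Qed.

Lemma ri_subset (R : realType) (d : nat) (S : set 'cV[R]_d) : ri S `<=` S.
Proof. by move=> x [hx /nbhs_singleton]; exact. Qed.

(** A segment ending in a relative interior point can be prolonged beyond it. *)
Lemma ri_prolong (R : realType) (d : nat) (S : set 'cV[R]_d) z0 z :
  ri S z0 -> S z -> exists2 e : R, 0 < e & S (z0 - e *: (z - z0)).
Proof.
move=> riz0 Sz; have Sz0 := ri_subset riz0.
have [_ /nbhs_norm2_ball[delta delta0 H]] := riz0.
have D0 : 0 < norm2 (z - z0) + 1 by rewrite ltr_wpDl ?norm2_ge0.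
pose e := delta / (norm2 (z - z0) + 1).
have e0 : 0 < e by rewrite divr_gt0.
exists e => //; apply: H.
  (* the prolonged point stays in the ball of radius [delta] around [z0] *)
  have -> : z0 - e *: (z - z0) - z0 = e *: (z0 - z).
    by apply/matrixP => i j; rewrite !mxE; ring.
  rewrite norm2Z ?(ltW e0) // /e mulrAC ler_pdivrMr // ler_pM2l //.
  have -> : norm2 (z0 - z) = norm2 (z - z0).
    apply/eqP; rewrite -(eqrXn2 (ltn0Sn 1)) ?norm2_ge0 // !norm2_sqr.
    by rewrite -(opprB z) dotpNl dotpNr opprK.
  by rewrite lerDl.
(* and it is the affine combination [(1 + e) z0 - e z] *)
exists 2, (fun i : 'I_2 => if i == 0 then 1 + e else - e),
  (fun i : 'I_2 => if i == 0 then z0 else z); split.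
- by rewrite !big_ord_recl big_ord0 /=; lra.
- by move=> i; case: ifP.
- rewrite !big_ord_recl big_ord0 /=.
  by apply/matrixP => i j; rewrite !mxE; ring.
Qed.

(** Strong duality: apply the supporting functional to the cone spanned by
    the pairs [(A z - b, r)] with [r >= F z - F x0].  Minimality of [x0] makes
    it nonnegative above [0], and the relative interior point makes its
    projection a subspace. *)
Lemma lagrange_multiplier (R : realType) (N m : nat) (F : 'cV[R]_N -> \bar R)
    (A : 'M[R]_(m, N)) (b : 'cV[R]_m) (x0 z0 : 'cV[R]_N) :
  proper_fun F -> convex_efun F ->
  (F x0 < +oo)%E -> (forall z, A *m z = b -> (F x0 <= F z)%E) ->
  ri (dom F) z0 -> A *m z0 = b ->
  exists y, forall z, (F x0 <= F z + (dotp y (A *m z - b))%:E)%E.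
Proof.
move=> pF cF Fx0 xmin riz0 Az0.
pose K (w : 'cV[R]_m) (r : R) := exists t z,
  [/\ 0 < t, (F z < +oo)%E, w = t *: (A *m z - b)
    & t * (fine (F z) - fine (F x0)) <= r].
have [||||y Hy] := @cone_supporting_functional R m K.
- move=> _ r _ r' [t [z [t0 Fz -> h]]] [t' [z' [t'0 Fz' -> h']]].
  (* the sum of two elements is represented by their weighted mean *)
  have tt0 : 0 < t + t' by rewrite addr_gt0.
  pose l := t / (t + t').
  have l0 : 0 <= l by rewrite divr_ge0 // ltW.
  have l1 : l <= 1 by rewrite ler_pdivrMr // mul1r lerDl ltW.
  have tl : (t + t') * l = t by rewrite /l mulrCA divff ?gt_eqF // mulr1.
  have tl' : (t + t') * (1 - l) = t' by rewrite mulrBr mulr1 tl; ring.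
  have := cF z z' l; rewrite l0 l1 => /(_ isT).
  rewrite (proper_fineK pF Fz) (proper_fineK pF Fz') -!EFinM -EFinD => c.
  have Fz'' : (F (l *: z + (1 - l) *: z')%R < +oo)%E.
    by apply: le_lt_trans c _; rewrite ltry.
  exists (t + t'), (l *: z + (1 - l) *: z'); split=> //.
    rewrite mulmxDr -!scalemxAr !scalerBr !scalerDr !scalerA tl tl' scalerDl.
    by rewrite opprD addrACA.
  rewrite (proper_fineK pF Fz'') lee_fin in c.
  apply: le_trans (lerD h h').
  set f'' := fine (F (l *: z + (1 - l) *: z')) in c *.
  have h2 := ler_wpM2l (ltW tt0) c.
  rewrite (mulrDr (t + t') (l * _)) (mulrA _ l) (mulrA _ (1 - l)) tl tl' in h2; lra.
- move=> t w r t0 [t' [z [t'0 Fz -> h]]].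
  exists (t * t'), z; split=> //; first by rewrite mulr_gt0.
    by rewrite scalerA.
  by rewrite -mulrA ler_pM2l.
- move=> r [t [z [t0 Fz w0 h]]].
  have Azb : A *m z = b.
    apply/eqP; rewrite -subr_eq0; move/eqP: w0.
    by rewrite eq_sym scaler_eq0 gt_eqF.
  apply: le_trans h; rewrite mulr_ge0 ?(ltW t0) // subr_ge0 -lee_fin.
  by rewrite -(proper_fineK pF Fz) -(proper_fineK pF Fx0) xmin.
- move=> w r [t [z [t0 Fz -> _]]].
  have [e e0 Fe] := ri_prolong riz0 Fz.
  exists (t / e * (fine (F (z0 - e *: (z - z0))) - fine (F x0))).
  exists (t / e), (z0 - e *: (z - z0)); split=> //; first by rewrite divr_gt0.
  rewrite mulmxBr -scalemxAr mulmxBr Az0 addrAC subrr add0r scalerN scalerA.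
  by rewrite divfK // gt_eqF.
exists y => z; have [Fz|Fz] := ltP (F z) +oo%E; last first.
  have -> : F z = +oo%E by apply/eqP; rewrite eq_le leey.
  by rewrite addye // leey.
have : K (A *m z - b) (fine (F z) - fine (F x0)).
  by exists 1, z; split=> //; rewrite ?scale1r ?mul1r.
move=> /Hy h; rewrite (proper_fineK pF Fx0) (proper_fineK pF Fz) -EFinD lee_fin.
lra.
Qed.

(** * Convergence of the iteration for a monotone operator *)

Lemma cvg_along (R : realType) (d : nat) (U : set_system nat)
    (x : nat -> 'cV[R]_d) (a : 'cV[R]_d) :
  \oo `<=` U -> x @ \oo --> a -> x @ U --> a.
Proof. by move=> oU xa; apply: cvg_trans xa; apply: cvg_app. Qed.

Lemma norm2_le_of_sqr (R : realType) (d : nat) (u : 'cV[R]_d) (B : R) :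
  dotp u u <= B -> norm2 u <= B + 1.
Proof.
move=> uB; have := sqr_ge0 (norm2 u - 1).
by rewrite sqrrB norm2_sqr expr1n mulr1 mulr2n; have := dotp_ge0 u; lra.
Qed.

Section MonotoneIteration.
Context {R : realType} {N m : nat}.
Variables (G : 'cV[R]_N -> 'cV[R]_N -> Prop).
Variables (A : 'M[R]_(m, N)) (b : 'cV[R]_m) (P U : 'M[R]_N).
Variables (beta u eps : R) (x : nat -> 'cV[R]_N) (y : nat -> 'cV[R]_m).

Hypothesis G_monotone : forall p1 g1 p2 g2,
  G p1 g1 -> G p2 g2 -> 0 <= dotp (g1 - g2) (p1 - p2).
Hypothesis G_closed : forall F : set_system nat, ProperFilter F ->
  forall (p g : nat -> 'cV[R]_N) (p0 g0 : 'cV[R]_N),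
  p @ F --> p0 -> g @ F --> g0 -> (forall k, G (p k) (g k)) -> G p0 g0.

Hypotheses (beta_gt0 : 0 < beta) (u_ge0 : 0 <= u) (eps_gt0 : 0 < eps).
Hypothesis P_sym : P^T = P.
Hypothesis P_coercive : forall v, (2 * u + eps) * dotp v v <= dotp (P *m v) v.
Hypothesis U_bounded : forall v w,
  dotp (U *m v) w <= u / 2 * (dotp v v + dotp w w).

Let d k := x k - x k.-1.

Hypothesis G_step : forall k, (1 <= k)%N ->
  G (x k.+1) (- (beta *: (P *m d k.+1 - U *m (d k.+1 - d k))) - A^T *m y k.+1).
Hypothesis y_step : forall k, (1 <= k)%N ->
  y k.+1 = y k + beta *: (A *m x k.+1 - b).

Definition saddle p q := G p (- (A^T *m q)) /\ A *m p = b.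

(** The first two terms are the usual distance to the saddle point.  The other
    two account for the delay: [dotp (U *m d k) (x k - p)] is what remains when
    [dotp (U *m (d k.+1 - d k)) (x k.+1 - p)] is telescoped, and
    [u / 2 * dotp (d k) (d k)] pays for the resulting cross term between
    [U *m d k] and [d k.+1]. *)
Definition energy p q k : R :=
  2^-1 * dotp (P *m (x k - p)) (x k - p)
  + 2^-1 * (beta ^+ 2)^-1 * dotp (y k - q) (y k - q)
  - dotp (U *m d k) (x k - p) + u / 2 * dotp (d k) (d k).

Lemma U_bounded_below v w :
  - (u / 2 * (dotp v v + dotp w w)) <= dotp (U *m v) w.
Proof.
by have := U_bounded v (- w); rewrite !dotpNr dotpNl opprK; lra.
Qed.

(** The term [u / 2 * dotp (d k) (d k)] and the part [2 u] of the coercivity of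
    [P] together dominate the indefinite term, by the bound on [U]. *)
Lemma energy_ge p q k :
  eps / 2 * dotp (x k - p) (x k - p)
  + 2^-1 * (beta ^+ 2)^-1 * dotp (y k - q) (y k - q) <= energy p q k.
Proof.
rewrite /energy.
have := P_coercive (x k - p); have := U_bounded (d k) (x k - p).
have := mulr_ge0 u_ge0 (dotp_ge0 (x k - p)).
set e := dotp (x k - p) _ => h1 h2 h3; lra.
Qed.

Lemma energy_ge0 p q k : 0 <= energy p q k.
Proof.
apply: le_trans (energy_ge p q k); apply: addr_ge0.
  by rewrite mulr_ge0 ?dotp_ge0 // divr_ge0 // ltW.
rewrite mulr_ge0 ?dotp_ge0 // mulr_ge0 ?invr_ge0 ?sqr_ge0 //.
Qed.

(** Expand the monotonicity inequality between the iterate and the saddle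
    point.  The cross terms in [x k.+1 - p] telescope, and what is left is
    controlled by [P >= 2 u + eps]. *)
Lemma energy_descent p q k : (1 <= k)%N -> saddle p q ->
  energy p q k.+1 + eps / 2 * dotp (d k.+1) (d k.+1)
  + 2^-1 * (beta ^+ 2)^-1 * dotp (y k.+1 - y k) (y k.+1 - y k)
  <= energy p q k.
Proof.
move=> k1 [Gp Ap]; have := G_monotone (G_step k1) Gp; rewrite /energy /=.
have Ae : A *m (x k.+1 - p) = beta^-1 *: (y k.+1 - y k).
  by rewrite mulmxBr Ap (y_step k1) addrAC subrr add0r scalerA mulVf ?gt_eqF ?scale1r.
have xe : x k - p = (x k.+1 - p) - d k.+1.
  by rewrite /d /=; apply/matrixP => i j; rewrite !mxE; ring.
have yq : y k - q = (y k.+1 - q) - (y k.+1 - y k).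
  by apply/matrixP => i j; rewrite !mxE; ring.
(* everything is expressed by the quantities at step [k.+1] and by increments *)
rewrite xe yq; move: Ae.
set e := x k.+1 - p; set h := y k.+1 - q; set dl := y k.+1 - y k => Ae.
set d1 := d k.+1; set d0 := d k.
have -> : - (beta *: (P *m d1 - U *m (d1 - d0))) - A^T *m y k.+1 - - (A^T *m q)
   = - (beta *: (P *m d1 - U *m (d1 - d0))) - A^T *m h.
  by rewrite /h (mulmxBr A^T) (opprB (A^T *m _)) opprK addrA addrAC.
clearbody e h dl d1 d0.
rewrite !(dotpBl, dotpNl, dotpZl) (mulmxBr U) [dotp (U *m d1 - _) e]dotpBl.
rewrite [dotp (A^T *m h) e]dotp_adj trmxK Ae dotpZr.
rewrite (mulmxBr P) !(dotpBl, dotpBr) (dotp_adj P d1 e) P_sym (dotpC d1 (P *m e)).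
rewrite (dotpC dl h).
have := U_bounded_below d0 d1; have := P_coercive d1.
set Ped := dotp (P *m e) d1; set Pee := dotp (P *m e) e.
set Pdd := dotp (P *m d1) d1; set hdl := dotp h dl; set dd := dotp dl dl.
set Ude := dotp (U *m d1) e; set U0e := dotp (U *m d0) e.
set U0d := dotp (U *m d0) d1; set d11 := dotp d1 d1; set d00 := dotp d0 d0.
set hh := dotp h h => hP hU hM.
have {}hM : Ped - (Ude - U0e) + (beta ^+ 2)^-1 * hdl <= 0.
  rewrite -(pmulr_rle0 _ beta_gt0) mulrDr mulrA.
  have -> : beta * (beta ^+ 2)^-1 = beta^-1.
    by rewrite expr2 invfM mulrA divff ?gt_eqF // mul1r.
  lra.
lra.
Qed.

Lemma energy_nonincreasing p q : saddle p q ->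
  nonincreasing_seq (fun k => energy p q k.+1).
Proof.
move=> sp; apply/nonincreasing_seqP => k.
have := energy_descent (ltn0Sn k) sp.
have : 0 <= eps / 2 * dotp (d k.+2) (d k.+2).
  by rewrite mulr_ge0 ?dotp_ge0 // divr_ge0 // ltW.
have : 0 <= 2^-1 * (beta ^+ 2)^-1 * dotp (y k.+2 - y k.+1) (y k.+2 - y k.+1).
  by rewrite mulr_ge0 ?dotp_ge0 // mulr_ge0 ?invr_ge0 ?sqr_ge0.
lra.
Qed.

Lemma energy_cvg p q : saddle p q -> cvgn (fun k => energy p q k.+1).
Proof.
move=> sp; apply: nonincreasing_is_cvgn; first exact: energy_nonincreasing.
by exists 0 => _ [k _ <-]; exact: energy_ge0.
Qed.

Lemma energy_drop_cvg0 p q : saddle p q ->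
  (fun k => energy p q k.+1 - energy p q k.+2) @ \oo --> 0.
Proof.
move=> sp; have /cvg_ex[l El] := energy_cvg sp.
rewrite -(subrr l); apply: cvgB => //.
by rewrite (cvg_shiftS (fun k => energy p q k.+1)).
Qed.

Lemma dotp_squeeze (n : nat) (v : nat -> 'cV[R]_n) (c : R) (r : nat -> R) :
  0 < c -> (forall k, c * dotp (v k) (v k) <= r k) -> r @ \oo --> 0 ->
  v @ \oo --> (0 : 'cV[R]_n).
Proof.
move=> c0 vr r0; apply: cvg_dotp0.
apply: (@squeeze_cvgr _ _ _ _ (fun=> 0) (fun k => c^-1 * r k)).
- apply: nearW => k; rewrite subr0 dotp_ge0 /=.
  by rewrite -(ler_pM2l c0) mulVKf ?gt_eqF.
- exact: cvg_cst.
- by rewrite -(mulr0 c^-1); apply: cvgM => //; exact: cvg_cst.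
Qed.

Lemma steps_cvg0 p q : saddle p q ->
  (fun k => d k.+1) @ \oo --> (0 : 'cV[R]_N)
  /\ (fun k => y k.+2 - y k.+1) @ \oo --> (0 : 'cV[R]_m).
Proof.
move=> sp; have E0 := energy_drop_cvg0 sp.
have ebeta0 : 0 < 2^-1 * (beta ^+ 2)^-1.
  by rewrite mulr_gt0 // invr_gt0 exprn_gt0.
have Dx k := mulr_ge0 (ltW (divr_gt0 eps_gt0 (ltr0n R 2))) (dotp_ge0 (d k.+2)).
have Dy k := mulr_ge0 (ltW ebeta0) (dotp_ge0 (y k.+2 - y k.+1)).
split.
  rewrite -(cvg_shiftS (fun k => d k.+1)).
  apply: (dotp_squeeze (c := eps / 2) _ _ E0); first by rewrite divr_gt0.
  by move=> k; have := energy_descent (ltn0Sn k) sp; have := Dy k; lra.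
apply: (dotp_squeeze ebeta0 _ E0).
by move=> k; have := energy_descent (ltn0Sn k) sp; have := Dx k; lra.
Qed.

(** Opial's argument: any cluster point of the iterates is a saddle point, and
    the energy relative to that very saddle point is monotone and tends to [0]
    along the ultrafilter, hence along the whole sequence. *)
Theorem monotone_iteration_cvg : (exists p q, saddle p q) ->
  exists p q, saddle p q /\ x @ \oo --> p.
Proof.
move=> [p [q sp]].
have ebeta0 : 0 < 2^-1 * (beta ^+ 2)^-1.
  by rewrite mulr_gt0 // invr_gt0 exprn_gt0.
have [F [UF oF]] := ultraFilterLemma eventually_filter.
have [dx0 dy0] := steps_cvg0 sp.
have dF := cvg_along oF dx0; have dyF := cvg_along oF dy0.
have dSF : (fun k => d k.+2) @ F --> (0 : 'cV[R]_N).
  by apply: cvg_along => //; rewrite (cvg_shiftS (fun k => d k.+1)).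
pose E0 := energy p q 1.
have E_le k : energy p q k.+2 <= E0 by exact: (energy_nonincreasing sp (leq0n k.+1)).
have Ex k := mulr_ge0 (ltW (divr_gt0 eps_gt0 (ltr0n R 2))) (dotp_ge0 (x k.+2 - p)).
have Ey k := mulr_ge0 (ltW ebeta0) (dotp_ge0 (y k.+2 - q)).
have [p' xp'] : exists p' : 'cV[R]_N, (fun k => x k.+2 - p) @ F --> p'.
  apply: (@ultra_bounded_cvg _ _ _ _ _ ((eps / 2)^-1 * E0 + 1)).
  apply: filterE => k; apply: norm2_le_of_sqr.
  rewrite -(ler_pM2l (divr_gt0 eps_gt0 (ltr0n R 2))) mulVKf; last first.
    by rewrite gt_eqF // divr_gt0.
  by have := energy_ge p q k.+2; have := E_le k; have := Ey k; lra.
have [q' yq'] : exists q' : 'cV[R]_m, (fun k => y k.+2 - q) @ F --> q'.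
  apply: (@ultra_bounded_cvg _ _ _ _ _ ((2^-1 * (beta ^+ 2)^-1)^-1 * E0 + 1)).
  apply: filterE => k; apply: norm2_le_of_sqr.
  rewrite -(ler_pM2l ebeta0) mulVKf ?gt_eqF //.
  by have := energy_ge p q k.+2; have := E_le k; have := Ex k; lra.
have xF : (fun k => x k.+2) @ F --> p' + p.
  rewrite (_ : (fun k => x k.+2) = (fun k => (x k.+2 - p) + p)).
    by apply: cvgD => //; exact: cvg_cst.
  by apply/funext => k; rewrite subrK.
have yF : (fun k => y k.+2) @ F --> q' + q.
  rewrite (_ : (fun k => y k.+2) = (fun k => (y k.+2 - q) + q)).
    by apply: cvgD => //; exact: cvg_cst.
  by apply/funext => k; rewrite subrK.
move: (p' + p) (q' + q) xF yF => ps qs xF yF {p' q' xp' yq'}.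
have sps : saddle ps qs.
  split.
    apply: (@G_closed F _ (fun k => x k.+2) (fun k =>
       - (beta *: (P *m d k.+2 - U *m (d k.+2 - d k.+1))) - A^T *m y k.+2)
       ps _ xF).
      have -> : - (A^T *m qs) =
          - (beta *: (P *m 0 - U *m (0 - 0))) - A^T *m qs.
        by rewrite !subr0 !mulmx0 subr0 scaler0 oppr0 add0r.
      apply: cvgB; last exact: cvg_mulmx.
      apply: cvgN; apply: cvgZ; first exact: cvg_cst.
      by apply: cvgB; apply: cvg_mulmx => //; apply: cvgB.
    by move=> k; exact: G_step.
  have h1 : (fun k => y k.+2 - y k.+1) @ F --> beta *: (A *m ps - b).
    under eq_fun => k do rewrite (y_step (ltn0Sn k)) addrAC subrr add0r.
    apply: cvgZ; first exact: cvg_cst.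
    by apply: cvgB; [exact: cvg_mulmx|exact: cvg_cst].
  have /eqP : beta *: (A *m ps - b) = 0.
    by apply: (cvg_unique _ h1 dyF); exact: norm_hausdorff.
  by rewrite scaler_eq0 gt_eqF //= subr_eq0 => /eqP.
exists ps, qs; split=> //.
have /cvg_ex[l El] := energy_cvg sps.
have l0 : l = 0.
  have h1 : (fun k => energy ps qs k.+2) @ F --> l.
    apply: cvg_trans (_ : (fun k => energy ps qs k.+2) @ \oo --> l).
      exact: cvg_app.
    by rewrite (cvg_shiftS (fun k => energy ps qs k.+1)).
  apply: (cvg_unique _ h1); first exact: norm_hausdorff.
  have xps : (fun k => x k.+2 - ps) @ F --> (0 : 'cV[R]_N).
    by rewrite -(subrr ps); apply: cvgB => //; exact: cvg_cst.
  have yqs : (fun k => y k.+2 - qs) @ F --> (0 : 'cV[R]_m).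
    by rewrite -(subrr qs); apply: cvgB => //; exact: cvg_cst.
  have -> : 0 = 2^-1 * dotp (P *m 0) (0 : 'cV[R]_N)
     + 2^-1 * (beta ^+ 2)^-1 * dotp (0 : 'cV[R]_m) 0
     - dotp (U *m 0) (0 : 'cV[R]_N) + u / 2 * dotp (0 : 'cV[R]_N) 0.
    by rewrite !dotp0r; ring.
  rewrite /energy; apply: cvgD; last first.
    by apply: cvgM; [exact: cvg_cst|exact: cvg_dotp].
  apply: cvgB; last by apply: cvg_dotp => //; exact: cvg_mulmx.
  apply: cvgD; apply: cvgM; try exact: cvg_cst; last exact: cvg_dotp.
  by apply: cvg_dotp => //; exact: cvg_mulmx.
rewrite -cvg_shiftS.
have h : (fun k => x k.+1 - ps) @ \oo --> (0 : 'cV[R]_N).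
  rewrite l0 in El.
  apply: (dotp_squeeze (c := eps / 2) _ _ El); first by rewrite divr_gt0.
  move=> k; have := energy_ge ps qs k.+1.
  by have := mulr_ge0 (ltW ebeta0) (dotp_ge0 (y k.+1 - qs)); lra.
have : (fun k => x k.+1 - ps + ps) @ \oo --> 0 + ps.
  by apply: cvgD => //; exact: cvg_cst.
by rewrite add0r; under eq_fun do rewrite subrK.
Qed.

End MonotoneIteration.

(** * Separable sums *)

Lemma sume_neqNy (R : realType) (I : finType) (P : pred I) (a : I -> \bar R) :
  (forall i, a i != -oo%E) -> (\sum_(i | P i) a i)%E != -oo%E.
Proof.
move=> aN; elim/big_ind: _ => // u v uN vN.
by rewrite adde_eq_ninfty negb_or uN.
Qed.

Section SeparableSum.
Context {R : realType} {s : nat} {n : 'I_s -> nat}.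
Variable f : forall i : 'I_s, 'cV[R]_(n i) -> \bar R.
Arguments f : clear implicits.
Hypothesis proper_f : forall i, proper_fun (f i).

Lemma dom_sepsumP x :
  (sepsum f x < +oo)%E <-> forall i, (f i (submxcol x i) < +oo)%E.
Proof.
split=> [Fx i|fx]; last by apply: lte_sum_pinfty => i _; exact: fx.
rewrite ltey; apply/eqP => fi; move: Fx.
rewrite /sepsum (bigD1 i) //= fi addye ?ltxx //.
by apply: sume_neqNy => j; exact: (proper_f j).1.
Qed.

Lemma proper_sepsum : proper_fun (sepsum f).
Proof.
split=> [x|]; first by apply: sume_neqNy => i; exact: (proper_f i).1.
have H i : exists z, (f i z < +oo)%E := (proper_f i).2.
pose z i := sval (cid (H i)); exists (\mxcol_i z i).
by apply/dom_sepsumP => i; rewrite mxcolK; exact: svalP (cid (H i)).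
Qed.

Lemma convex_sepsum : (forall i, convex_efun (f i)) -> convex_efun (sepsum f).
Proof.
move=> cf x y t /[dup] t01 /andP[t0 t1]; rewrite /sepsum.
have fN i z : f i z != -oo%E by exact: (proper_f i).1.
rewrite !fin_num_sume_distrr //; try by move=> i j _ _; exact: neqNy_adde_def.
rewrite -big_split /=; apply: lee_sum => i _.
have -> : submxcol (t *: x + (1 - t) *: y) i =
    t *: submxcol x i + (1 - t) *: submxcol y i.
  by apply/matrixP => k l; rewrite !mxE.
exact: cf.
Qed.

End SeparableSum.

(** * Block operators of the iteration *)

Lemma mul_mxrow_blocks (R : realType) (s m : nat) (n : 'I_s -> nat)
    (A : forall i : 'I_s, 'M[R]_(m, n i)) (z : 'cV[R]_(\sum_i n i)) :
  (\mxrow_i A i) *m z = \sum_i A i *m submxcol z i.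
Proof. by rewrite -{1}(submxcolK z) mul_mxrow_mxcol. Qed.

Lemma submxcolZ (R : realType) (s : nat) (n : 'I_s -> nat)
    (c : R) (z : 'cV[R]_(\sum_i n i)) i :
  submxcol (c *: z) i = c *: submxcol z i.
Proof. by apply/matrixP => k l; rewrite !mxE. Qed.

Lemma sum_ord_around (V : nmodType) (s : nat) (j : 'I_s) (F : 'I_s -> V) :
  \sum_i F i = \sum_(i < s | (i < j)%N) F i + F j + \sum_(i < s | (j < i)%N) F i.
Proof.
rewrite (bigID (fun i : 'I_s => (i < j)%N)) /= -addrA; congr (_ + _).
rewrite (bigD1 j) ?ltnn //=; congr (_ + _); apply: eq_bigl => i.
by rewrite -leqNgt [RHS]ltn_neqAle andbC eq_sym.
Qed.

Lemma pos_family_lower_bound (R : realType) (I : finType) (c : I -> R) :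
  (forall i, 0 < c i) -> exists2 e, 0 < e & forall i, e <= c i.
Proof.
move=> c0; exists (\big[Num.min/1]_i c i).
  by elim/big_ind: _ => // a b a0 b0; rewrite lt_min a0.
by move=> i; exact: bigmin_le.
Qed.

Section Blocks.
Context {R : realType} {s m : nat} {n : 'I_s -> nat}.
Variables (A : forall i : 'I_s, 'M[R]_(m, n i)) (alpha : 'I_s -> R).

(** The metric of the proximal steps, reduced by the block-diagonal part of
    [A^T A]. *)
Definition stepmx : 'M[R]_(\sum_i n i) :=
  \mxdiag_i ((alpha i)^-1%:M - (A i)^T *m A i).

Definition uppermx : 'M[R]_(\sum_i n i) :=
  \mxblock_(i < s, j < s) (if (i < j)%N then (A i)^T *m A j else 0).

Lemma submxcol_stepmx (v : 'cV[R]_(\sum_i n i)) j :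
  submxcol (stepmx *m v) j =
  (alpha j)^-1 *: submxcol v j - (A j)^T *m (A j *m submxcol v j).
Proof.
rewrite -{1}(submxcolK v) /stepmx mul_mxdiag_mxcol mxcolK mulmxBl.
by rewrite mul_scalar_mx mulmxA.
Qed.

Lemma submxcol_uppermx (v : 'cV[R]_(\sum_i n i)) j :
  submxcol (uppermx *m v) j =
  (A j)^T *m \sum_(i < s | (j < i)%N) A i *m submxcol v i.
Proof.
rewrite -{1}(submxcolK v) /uppermx mxblockEv mxcol_mul mxcolK mul_mxrow_mxcol.
rewrite mulmx_sumr [RHS]big_mkcond /=; apply: eq_bigr => i _.
by case: ifP; rewrite ?mul0mx // mulmxA.
Qed.

Lemma submxcol_tr_mxrow (y : 'cV[R]_m) j :
  submxcol ((\mxrow_i A i)^T *m y) j = (A j)^T *m y.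
Proof. by rewrite tr_mxrow mxcol_mul mxcolK. Qed.

Lemma stepmx_sym : stepmx^T = stepmx.
Proof.
rewrite /stepmx tr_mxdiag; apply: eq_mxdiag => i.
by rewrite linearB /= tr_scalar_mx trmx_mul trmxK.
Qed.

Lemma stepmx_coercive (c : R) (v : 'cV[R]_(\sum_i n i)) :
  (forall i, (0 < n i)%N) ->
  (forall i, specnorm (A i) ^+ 2 + c <= (alpha i)^-1) ->
  c * dotp v v <= dotp (stepmx *m v) v.
Proof.
move=> n0 hc; rewrite !dotp_blocks mulr_sumr; apply: ler_sum => i _.
rewrite submxcol_stepmx dotpBl dotpZl dotp_adj trmxK.
set w := submxcol v i.
have h1 := specnorm_sqr_le (A i) (n0 i) w.
have h2 := ler_wpM2r (dotp_ge0 w) (hc i).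
lra.
Qed.

Lemma uppermx_bounded (v w : 'cV[R]_(\sum_i n i)) : (0 < m)%N ->
  dotp (uppermx *m v) w <= specnorm (M2tilde A) / 2 * (dotp v v + dotp w w).
Proof.
move=> m0.
have dot0 (a c : 'cV[R]_(\sum_i n i)) :
    dotp (col_mx a (0 : 'cV[R]_m)) (col_mx c 0) = dotp a c.
  by rewrite /dotp tr_col_mx mul_row_col mulmx0 addr0.
(* [uppermx A] is the nonzero block of [M2tilde A] *)
have q0 : (0 < \sum_i n i + m)%N by rewrite addn_gt0 m0 orbT.
have := specnorm_le (M2tilde A) q0 (col_mx v 0) (col_mx w 0).
rewrite /M2tilde mul_block_col !mul0mx !addr0 dot0 -/(M2tilde A) -/uppermx.
move/le_trans; apply; rewrite -mulrA ler_wpM2l ?specnorm_ge0 //.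
rewrite -(dot0 v v) -(dot0 w w) -!norm2_sqr.
have := sqr_ge0 (norm2 (col_mx v (0 : 'cV[R]_m)) - norm2 (col_mx w (0 : 'cV[R]_m))).
rewrite sqrrB; lra.
Qed.

End Blocks.

Definition block_subgradient {R : realType} {s : nat} {n : 'I_s -> nat}
    (f : forall i : 'I_s, 'cV[R]_(n i) -> \bar R)
    (x g : 'cV[R]_(\sum_i n i)) : Prop :=
  forall i, subgradient (f i) (submxcol x i) (submxcol g i).

Section BlockSubgradient.
Context {R : realType} {s m : nat} {n : 'I_s -> nat}.
Variable f : forall i : 'I_s, 'cV[R]_(n i) -> \bar R.
Arguments f : clear implicits.
Hypothesis f_Gamma0 : forall i, Gamma0 (f i).

Let proper_f i : proper_fun (f i). Proof. by case: (f_Gamma0 i). Qed.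

Lemma block_subgradient_monotone p1 g1 p2 g2 :
  block_subgradient f p1 g1 -> block_subgradient f p2 g2 ->
  0 <= dotp (g1 - g2) (p1 - p2).
Proof.
move=> G1 G2; rewrite dotp_blocks; apply: sumr_ge0 => i _.
by rewrite !submxcolB; exact: subgradient_monotone (proper_f i) (G1 i) (G2 i).
Qed.

Lemma block_subgradient_closed (F : set_system nat) : ProperFilter F ->
  forall (p g : nat -> 'cV[R]_(\sum_i n i)) (p0 g0 : 'cV[R]_(\sum_i n i)),
  p @ F --> p0 -> g @ F --> g0 ->
  (forall k, block_subgradient f (p k) (g k)) -> block_subgradient f p0 g0.
Proof.
move=> FF p g p0 g0 pp0 gg0 pg i.
apply: (subgradient_closed (F := F) (x := fun k => submxcol (p k) i)
  (g := fun k => submxcol (g k) i)) => //.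
- by case: (f_Gamma0 i).
- exact: cvg_submxcol.
- exact: cvg_submxcol.
- by apply: filterE => k; exact: pg.
Qed.

Variables (A : forall i : 'I_s, 'M[R]_(m, n i)) (b : 'cV[R]_m).

(** The joint Lagrangian inequality splits into blocks: compare [x0] with the
    points that differ from it in the block [j] only. *)
Lemma lagrange_block_subgradient x0 (y : 'cV[R]_m) :
  (sepsum f x0 < +oo)%E -> (\mxrow_i A i) *m x0 = b ->
  (forall z, (sepsum f x0 <=
     sepsum f z + (dotp y ((\mxrow_i A i) *m z - b))%:E)%E) ->
  block_subgradient f x0 (- ((\mxrow_i A i)^T *m y)).
Proof.
move=> /(dom_sepsumP proper_f) fx0 Ax0 H j; split=> // zj.
have [fz|] := ltP (f j zj) +oo%E; last by apply: le_trans; rewrite leey.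
pose z := \mxcol_i (dfwith (fun i => submxcol x0 i) j zj i).
have zjj : submxcol z j = zj by rewrite mxcolK dfwithin.
have zij i : i != j -> submxcol z i = submxcol x0 i.
  by move=> ij; rewrite mxcolK dfwithout // eq_sym.
have := H z; rewrite /sepsum (bigD1 j) //= [in leRHS](bigD1 j) //= zjj.
rewrite [X in (_ <= _ + X + _)%E](eq_bigr (fun i => f i (submxcol x0 i))); last first.
  by move=> i ij; rewrite zij.
have Azb : (\mxrow_i A i) *m z - b = A j *m (zj - submxcol x0 j).
  rewrite -Ax0 -mulmxBr mul_mxrow_blocks (bigD1 j) //= submxcolB zjj big1 ?addr0 //.
  by move=> i ij; rewrite submxcolB zij // subrr mulmx0.
rewrite Azb.
rewrite (eq_bigr (fun i => (fine (f i (submxcol x0 i)))%:E)); last first.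
  by move=> i _; rewrite -proper_fineK.
rewrite sumEFin (proper_fineK (proper_f j) (fx0 j)) (proper_fineK (proper_f j) fz).
rewrite -!EFinD !lee_fin submxcolN submxcol_tr_mxrow dotpNl.
rewrite (dotpC y) dotp_adj dotpC; lra.
Qed.

(** Summing the subgradient inequalities over the blocks, the linear terms add
    up to [- dotp q (A z - A p)], which vanishes on the feasible set. *)
Lemma saddle_argmin p q :
  saddle (block_subgradient f) (\mxrow_i A i) b p q ->
  argmin (feasible A b) (sepsum f) p.
Proof.
move=> [Gp Ap]; split=> [|z]; first by rewrite /feasible /= -mul_mxrow_blocks.
rewrite /feasible /= -mul_mxrow_blocks => Az.
have [Fz|] := ltP (sepsum f z) +oo%E; last by apply: le_trans; rewrite leey.
have fz := (dom_sepsumP proper_f z).1 Fz.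
have fp i : (f i (submxcol p i) < +oo)%E by case: (Gp i).
have E w : (forall i, f i (submxcol w i) < +oo)%E ->
    sepsum f w = (\sum_i fine (f i (submxcol w i)))%:E.
  move=> fw; rewrite -sumEFin; apply: eq_bigr => i _.
  exact: proper_fineK.
rewrite !E // lee_fin -subr_ge0 -sumrB.
have h0 : dotp (- ((\mxrow_i A i)^T *m q)) (z - p) = 0.
  by rewrite dotpNl dotpC -dotp_adj mulmxBr Az Ap subrr dotp0l oppr0.
rewrite -[leLHS]h0 dotp_blocks; apply: ler_sum => i _.
have := (Gp i).2 (submxcol z i).
rewrite (proper_fineK (proper_f i) (fp i)) (proper_fineK (proper_f i) (fz i)).
by rewrite -EFinD lee_fin submxcolB; lra.
Qed.

(** Eliminating [y k] in favour of [y k.+1] turns the proximal step into an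
    implicit one, with the delayed blocks collected in [uppermx]. *)
Lemma prox_step_subgradient (alpha : 'I_s -> R) (beta : R)
    (x0 x1 x2 : 'cV[R]_(\sum_i n i)) (y1 y2 : 'cV[R]_m) :
  0 < beta -> (forall i, 0 < alpha i) ->
  (forall j : 'I_s, submxcol x2 j =
      prox (fun u => ((alpha j / beta)%:E * f j u)%E)
        (submxcol x1 j
         - alpha j *: ((A j)^T *m
             (\sum_(i < s | (i < j)%N) A i *m submxcol x2 i
              + A j *m submxcol x1 j
              + \sum_(i < s | (j < i)%N)
                  A i *m (2 *: submxcol x1 i - submxcol x0 i)
              - b))
         - (alpha j / beta) *: ((A j)^T *m y1))) ->
  y2 = y1 + beta *: ((\mxrow_i A i) *m x2 - b) ->
  block_subgradient f x2
    (- (beta *: (stepmx A alpha *m (x2 - x1)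
                 - uppermx A *m (x2 - x1 - (x1 - x0))))
     - (\mxrow_i A i)^T *m y2).
Proof.
move=> beta0 alpha0 hx hy j.
have c0 : 0 < alpha j / beta by rewrite divr_gt0.
set g := submxcol (_ - _) j.
set S := \sum_(i < s | (i < j)%N) A i *m submxcol x2 i
  + A j *m submxcol x1 j
  + \sum_(i < s | (j < i)%N) A i *m (2 *: submxcol x1 i - submxcol x0 i) - b.
(* splitting [A x2] around the block [j] makes the increments appear *)
have SE : S = (\mxrow_i A i) *m x2 - b - A j *m submxcol (x2 - x1) j
    - \sum_(i < s | (j < i)%N) A i *m submxcol (x2 - x1 - (x1 - x0)) i.
  rewrite mul_mxrow_blocks (sum_ord_around j) /S submxcolB mulmxBr.
  have -> : \sum_(i < s | (j < i)%N) A i *m (2 *: submxcol x1 i - submxcol x0 i)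
     = \sum_(i < s | (j < i)%N) A i *m submxcol x2 i
       - \sum_(i < s | (j < i)%N) A i *m submxcol (x2 - x1 - (x1 - x0)) i.
    rewrite -sumrB; apply: eq_bigr => i _; rewrite -mulmxBr; congr (_ *m _).
    by rewrite !submxcolB; apply/matrixP => k l; rewrite !mxE; ring.
  by apply/matrixP => k l; rewrite !mxE; ring.
have -> : g = (alpha j / beta)^-1 *: (submxcol x1 j - alpha j *: ((A j)^T *m S)
    - (alpha j / beta) *: ((A j)^T *m y1) - submxcol x2 j).
  rewrite /g hy submxcolB submxcolN submxcolZ submxcolB submxcol_stepmx.
  rewrite submxcol_uppermx submxcol_tr_mxrow SE.
  set T := \sum_(i < s | (j < i)%N) _.
  rewrite !submxcolB !(mulmxDr, mulmxN) -!scalemxAr !(mulmxDr, mulmxN).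
  move: (submxcol x1 j) (submxcol x2 j) (_ *m (A j *m _)) (_ *m (A j *m _))
    => t1 t2 t3 t4.
  move: ((A j)^T *m T) ((A j)^T *m b) ((A j)^T *m y1) ((A j)^T *m _) => t5 t6 t7 t8.
  apply/matrixP => k l; rewrite !mxE.
  have a0 : alpha j != 0 by rewrite gt_eqF.
  have b0 : beta != 0 by rewrite gt_eqF.
  by field; rewrite ?a0 ?b0.
apply: (subgradient_unscale c0 (proper_f j)).
by rewrite hx; apply: prox_subgradient; exact: Gamma0_scale.
Qed.

End BlockSubgradient.

(** * Convergence of the splitting method *)

(** For [D = 0] the hypothesis reads [a < +oo], but then [D < a^-1] is just the
    positivity of [a]. *)
Lemma lt_inv_of_lt_div (R : realType) (a D : R) : 0 < a -> 0 <= D ->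
  (a%:E < 1 / D%:E)%E -> D < a^-1.
Proof.
move=> a0; rewrite le_eqVlt => /orP[/eqP <- _|D0]; first by rewrite invr_gt0.
rewrite div1e inver gt_eqF // lte_fin => h.
by rewrite -(invrK D) ltf_pV2 // posrE invr_gt0.
Qed.

Theorem theorem6p5 (R : realType) (s m : nat) (n : 'I_s -> nat)
  (hs : (0 < s)%N) (hm : (0 < m)%N) (hn : forall i, (0 < n i)%N)
  (f : forall i : 'I_s, 'cV[R]_(n i) -> \bar R)
  (hf : forall i, Gamma0 (f i))
  (A : forall i : 'I_s, 'M[R]_(m, n i)) (b : 'cV[R]_m)
  (alpha : 'I_s -> R) (halpha : forall i, 0 < alpha i)
  (beta : R) (hbeta : 0 < beta)
  (hsol : exists z, argmin (feasible A b) (sepsum f) z)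
  (hri : ((fun z => (\mxrow_i A i) *m z) @` ri (dom (sepsum f))) b)
  (x : nat -> 'cV[R]_(\sum_i n i)) (y : nat -> 'cV[R]_m)
  (hx : forall k : nat, (1 <= k)%N -> forall j : 'I_s,
    submxcol (x k.+1) j =
      prox (fun u => ((alpha j / beta)%:E * f j u)%E)
        (submxcol (x k) j
         - alpha j *: ((A j)^T *m
             (\sum_(i < s | (i < j)%N) A i *m submxcol (x k.+1) i
              + A j *m submxcol (x k) j
              + \sum_(i < s | (j < i)%N)
                  A i *m (2 *: submxcol (x k) i - submxcol (x k.-1) i)
              - b))
         - (alpha j / beta) *: ((A j)^T *m y k)))
  (hy : forall k : nat, (1 <= k)%N ->
    y k.+1 = y k + beta *: (\sum_(i < s) A i *m submxcol (x k.+1) i - b))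
  (hstep : forall i : 'I_s,
    ((alpha i)%:E <
       1 / (specnorm (A i) ^+ 2 + 2 * specnorm (M2tilde A))%:E)%E) :
  exists2 xs, argmin (feasible A b) (sepsum f) xs & x @ \oo --> xs.
Proof.
have proper_f i : proper_fun (f i) by case: (hf i).
have convex_f i : convex_efun (f i) by case: (hf i).
pose B := \mxrow_i A i.
have feasibleE z : feasible A b z <-> B *m z = b.
  by rewrite /feasible /= mul_mxrow_blocks.
have [p0 [p0b p0min]] := hsol; have [z0 z0ri z0b] := hri.
have Fp0 : (sepsum f p0 < +oo)%E.
  apply: le_lt_trans (p0min z0 _) (ri_subset z0ri).
  exact/feasibleE.
have [q0 Hq0] : exists q, forall z,
    (sepsum f p0 <= sepsum f z + (dotp q (B *m z - b))%:E)%E.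
  apply: (lagrange_multiplier (z0 := z0)) => //.
  - exact: proper_sepsum.
  - exact: convex_sepsum.
  - by move=> z /feasibleE; exact: p0min.
have saddle0 : saddle (block_subgradient f) B b p0 q0.
  have Bp0 : B *m p0 = b by exact/feasibleE.
  split=> //; exact: (lagrange_block_subgradient hf Fp0 Bp0 Hq0).
(* the step-size bound is strict, hence uniform over the finitely many blocks *)
pose u := specnorm (M2tilde A).
have u_ge0 : 0 <= u by apply: specnorm_ge0; rewrite addn_gt0 hm orbT.
have [eps eps_gt0 Heps] : exists2 eps, 0 < eps &
    forall i, eps <= (alpha i)^-1 - (specnorm (A i) ^+ 2 + 2 * u).
  apply: pos_family_lower_bound => i; rewrite subr_gt0.
  apply: lt_inv_of_lt_div => //.
  by rewrite addr_ge0 ?sqr_ge0 // mulr_ge0.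
have [ps [qs [sps xps]]] : exists p q,
    saddle (block_subgradient f) B b p q /\ x @ \oo --> p.
  apply: (@monotone_iteration_cvg R _ m (block_subgradient f) B b
    (stepmx A alpha) (uppermx A) beta u eps x y) => //.
  - exact: block_subgradient_monotone.
  - exact: block_subgradient_closed.
  - exact: stepmx_sym.
  - move=> v; apply: stepmx_coercive => // i.
    by have := Heps i; lra.
  - by move=> v w; exact: uppermx_bounded.
  - move=> k k1; apply: (prox_step_subgradient hf hbeta halpha (y1 := y k)).
      by move=> j; exact: hx.
    by rewrite mul_mxrow_blocks; exact: hy.
  - by move=> k k1; rewrite mul_mxrow_blocks; exact: hy.
  - by exists p0, q0.
by exists ps => //; exact: saddle_argmin sps.
Qed.
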